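(* There exist absolute constants $c_1,c_2,c_3,c_4>0$ such that for every $C>1$ there exist an integer $k\le c_1C$ and a noise matrix $H\in[0,1]^{k\times k}$ with $\min_{i\ne j}(H_{ii}-H_{ij})\ge c_2/C$ such that the following holds for every $d\in\mathbb{Z}_+$ that is sufficiently large depending on $C$. Any SQ algorithm that distribution-free learns multiclass linear classifiers on $\mathbb{R}^d$ with random classification noise specified by $H$ to error $C\cdot\mathrm{opt}$, given the promise that $\mathrm{opt}\ge c_3/C$, either (a) requires at least $d^{\,c_4\log^{0.99} d}$ queries, or (b) requires a query of tolerance at most $1/d^{\,c_4\log^{0.99} d}$.
   Context: A multiclass linear classifier on $\mathbb{R}^d$ with $k$ labels is a function $f(x)=\mathrm{argmax}_{i\in[k]}\, w_i\cdot x$ with $w_1,\dots,w_k\in\mathbb{R}^d$, ties broken by the smallest index. A noise matrix is a row-stochastic matrix $H\in[0,1]^{k\times k}$ (each row sums to $1$). An instance of multiclass linear classification with random classification noise (RCN) specified by $H$ is a triple $(D,f^*,H)$, where $f^*$ is a multiclass linear classifier and $D$ is a distribution of $(x,y)\in\mathbb{R}^d\times[k]$ with arbitrary marginal $D_X$ on $x$ and $\Pr(y=j\mid x)=H_{f^*(x)\,j}$ for all $j\in[k]$. The error of $h:\mathbb{R}^d\to[k]$ is $\mathrm{err}(h)=\Pr_{(x,y)\sim D}(h(x)\ne y)$, and $\mathrm{opt}$ is the minimum of $\mathrm{err}(f)$ over multiclass linear classifiers $f$. A statistical query is a function $q:\mathbb{R}^d\times[k]\to[-1,1]$; the oracle $\mathrm{STAT}(\tau)$,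 given $q$, returns some value $v$ with $|v-\mathbb{E}_{(x,y)\sim D}[q(x,y)]|\le\tau$, where $\tau>0$ is the tolerance of the query. A statistical query (SQ) algorithm accesses the unknown $D$ only through adaptive calls to such oracles. $H$ is known to the algorithm. An SQ algorithm distribution-free learns multiclass linear classifiers with RCN specified by $H$ to error $\eta$ under a promise on $\mathrm{opt}$ if for every instance $(D,f^*,H)$ satisfying the promise, and for all valid oracle answers, it outputs a hypothesis $\hat h$ with $\mathrm{err}(\hat h)\le\eta$ (here $\eta=C\cdot\mathrm{opt}$ may depend on the instance). *)

(* Defs.v *)
From HB Require Import structures.
From mathcomp Require Import all_boot all_order all_algebra.
From mathcomp Require Import all_classical all_reals all_analysis.

Set Implicit Arguments.
Unset Strict Implicit.
Unset Printing Implicit Defensive.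

Import Order.TTheory GRing.Theory Num.Theory.
Import numFieldNormedType.Exports.

Local Open Scope classical_set_scope.
Local Open Scope ring_scope.

(* A vector of R^d is a [d.-tuple R], which carries the product (= Borel)
   sigma-algebra. The label set is ['I_m.+1] with the discrete
   one, that is k = m.+1: a [measurableType] has to be inhabited. *)
HB.instance Definition _ (m : nat) := isPointed.Build 'I_m.+1 ord0.
HB.instance Definition _ (m : nat) :=
  @isMeasurable.Build default_measure_display 'I_m.+1
    discrete_measurable (@discrete_measurable0 'I_m.+1)
    (@discrete_measurableC 'I_m.+1) (@discrete_measurableU 'I_m.+1).

Section Classification.
Context {R : realType} {d m : nat}.

Definition dotp (w x : d.-tuple R) : R := \sum_(i < d) tnth w i * tnth x i.

Definition is_smallest_argmax (s : 'I_m.+1 -> R) (i : 'I_m.+1) : Prop :=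
  (forall j, s j <= s i) /\ (forall j : 'I_m.+1, (j < i)%N -> s j < s i).

Definition linear_classifier (f : d.-tuple R -> 'I_m.+1) : Prop :=
  exists w : 'I_m.+1 -> d.-tuple R,
    forall x, is_smallest_argmax (fun i => dotp (w i) x) (f x).

Definition noise_matrix (H : 'M[R]_m.+1) : Prop :=
  (forall i j, 0 <= H i j <= 1) /\ (forall i, \sum_j H i j = 1).

Implicit Types (D : probability (d.-tuple R * 'I_m.+1)%type R).

(* [D_X], the marginal of [D] on the example. *)
Definition marginalX D : set (d.-tuple R) -> \bar R := pushforward D fst.

(* The last clause says that [fun x => H (f x) j] is a version of the
   conditional probability Pr(y = j | x). *)
Definition rcn_instance (H : 'M[R]_m.+1) D (f : d.-tuple R -> 'I_m.+1) : Prop :=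
  linear_classifier f /\
  forall (A : set (d.-tuple R)) (j : 'I_m.+1), measurable A ->
    D (A `*` [set j]) = (\int[marginalX D]_(x in A) (H (f x) j)%:E)%E.

Definition err D (h : d.-tuple R -> 'I_m.+1) : R :=
  fine (D [set z | h z.1 <> z.2]).

(* On an instance whose noise matrix satisfies [H i j < H i i] for [j != i], the
   target [f] is Bayes optimal and this infimum is the minimum. *)
Definition opt D : R := inf [set err D f | f in linear_classifier].

Record stat_query := StatQuery {
  query_fun : {mfun (d.-tuple R * 'I_m.+1)%type >-> R};
  query_bound : forall z, -1 <= query_fun z <= 1;
  tolerance : R;
  tolerance_gt0 : 0 < tolerance }.

Definition valid_answer D (q : stat_query) (a : R) : Prop :=
  `|a - fine 'E_D[query_fun q]| <= tolerance q.

Inductive sq_action :=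
| Ask of stat_query
| Output of {mfun d.-tuple R >-> 'I_m.+1}.

(* An adaptive algorithm chooses its next action from the answers it has
   received so far, oldest first. *)
Definition sq_algorithm := seq R -> sq_action.

(* [s] lists the answers of a partial run of [A] on [D]: [A] has asked
   [size s] queries and each of them was answered within its tolerance. *)
Definition transcript D (A : sq_algorithm) (s : seq R) : Prop :=
  forall n, (n < size s)%N ->
    exists2 q, A (take n s) = Ask q & valid_answer D q (nth 0 s n).

(* Whatever the valid answers, [A] halts and its output satisfies [P]. *)
Definition always_outputs D (A : sq_algorithm)
    (P : (d.-tuple R -> 'I_m.+1) -> Prop) : Prop :=
  (forall a : nat -> R, ~ forall n, transcript D A (mkseq a n)) /\
  (forall s h, transcript D A s -> A s = Output h -> P h).

(* [eta] is a target error that may depend on the instance. *)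
Definition sq_learns (H : 'M[R]_m.+1)
    (promise : probability (d.-tuple R * 'I_m.+1)%type R -> Prop)
    (eta : probability (d.-tuple R * 'I_m.+1)%type R -> R)
    (A : sq_algorithm) : Prop :=
  forall D f, rcn_instance H D f -> promise D ->
    always_outputs D A (fun h => err D h <= eta D).

(* Worst-case costs, over the promised instances and the valid answers. *)
Definition requires_queries (H : 'M[R]_m.+1)
    (promise : probability (d.-tuple R * 'I_m.+1)%type R -> Prop)
    (A : sq_algorithm) (N : R) : Prop :=
  exists D f s, [/\ rcn_instance H D f, promise D, transcript D A s &
    N <= (size s)%:R].

Definition requires_tolerance (H : 'M[R]_m.+1)
    (promise : probability (d.-tuple R * 'I_m.+1)%type R -> Prop)
    (A : sq_algorithm) (t : R) : Prop :=
  exists D f s q, [/\ rcn_instance H D f, promise D, transcript D A s,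
    A s = Ask q & tolerance q <= t].

End Classification.

Arguments stat_query R d m : clear implicits.
Arguments sq_action R d m : clear implicits.
Arguments sq_algorithm R d m : clear implicits.

(* Main.v *)
(* The noise matrix has K ordinary classes and one extra class [ord_max]; every
   label becomes [ord_max] with probability beta = 2/K, and the row of [ord_max]
   is otherwise the average of the other rows. Hence an example of the extra
   class carries a uniformly random ordinary label.

   A secret f : {0..s-1} -> bool selects 2s of 4s independent uniform
   coordinates in {0..Q-1}. With t the sum of the selected ones and y a uniform
   ordinary label, one more coordinate x_0 is set so that x_0 + t = jQ, where
   j = ceil (t / Q), and is then increased by y if |j - s| <= L. In the latter
   case, which by Chebyshev's inequality fails with probability at most
   s / (2 L^2), the target class is y, otherwise it is [ord_max]. The class is a
   function of x_0 + t given by 2L+1 short blocks of consecutive integers,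
   hence by polynomials of degree O(KL), and these are linear after a Veronese
   embedding. With s = w^2 and L = Kw the embedding has dimension w^O(w), while
   there are 2^(w^2) secrets.

   Shifting x_0 by y in 2L+1 blocks is invisible at scale 1/Q, because the sum
   of two uniform coordinates has a 1/Q^2-Lipschitz probability mass function.
   Therefore two different secrets give nearly uncorrelated deviations from the
   distribution where x_0 is uniform, and every bounded query, including the
   error of a hypothesis, sees a deviation above 1/N for O(Q N^2) secrets only.
   Answering all queries as if x_0 were uniform is thus valid for some secret,
   whereas no hypothesis predicts the label well when x_0 is uniform. *)
From HB Require Import structures.
Require Import Defs.
From mathcomp Require Import all_boot all_order all_algebra.
From mathcomp Require Import all_classical all_reals all_analysis.
From mathcomp Require Import measurable_realfun zify ring lra.

Set Implicit Arguments.
Unset Strict Implicit.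
Unset Printing Implicit Defensive.

Import Order.TTheory GRing.Theory Num.Theory.

(** * Arithmetic of the lead coordinate *)

(** This is -t modulo Q, the distance from t up to the next multiple of Q; [level] is the ceiling of
    t / Q. *)
Definition gap (Q t : nat) : nat := Q.-1 - (t + Q.-1) %% Q.
Definition level (Q t : nat) : nat := (t + Q.-1) %/ Q.
Definition central (s L j : nat) : bool := (s <= j + L) && (j <= s + L).
(* The coordinate x_0 when the selected coordinates sum to t. *)
Definition lead (s L y Q t : nat) : nat :=
  gap Q t + (if central s L (level Q t) then y else 0).

Lemma gap_lt Q t : 0 < Q -> gap Q t < Q.
Proof. by rewrite /gap; lia. Qed.

Lemma add_gap Q t : 0 < Q -> t + gap Q t = level Q t * Q.
Proof.
move=> Q0; rewrite /gap /level.
have := divn_eq (t + Q.-1) Q; have := ltn_pmod (t + Q.-1) Q0.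
lia.
Qed.

Lemma gap_level_uniq Q t g j :
  g < Q -> t + g = j * Q -> gap Q t = g /\ level Q t = j.
Proof.
move=> gQ tg; have Q0 : 0 < Q by lia.
have h1 := add_gap t Q0; have h2 := gap_lt t Q0.
have : level Q t = j.
  apply/eqP; rewrite eqn_leq; apply/andP; split; rewrite leqNgt; apply/negP => h; nia.
by move=> lj; split=> //; lia.
Qed.

(** * Counting the values of the lead when one or two summands vary *)

Section Counting.
Variables (Q s L : nat).
Hypothesis Q_gt0 : 0 < Q.

Lemma sum_pred_le1 (T : finType) (P : pred T) :
  (forall a b, P a -> P b -> a = b) -> \sum_(a : T) P a <= 1.
Proof.
move=> uP; rewrite -big_mkcond sum1_card; apply/card_le1_eqP => a b Pa Pb.
exact: uP.
Qed.

(** As p runs through a full period, [gap] takes each residue once. *)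
Lemma count_gap_le c g : \sum_(p < Q) (gap Q (c + p) == g) <= (g < Q).
Proof.
case: ltnP => [gQ|Qg]; last first.
  rewrite big1// => p _; apply/eqP; rewrite eqb0; apply/eqP.
  by have := gap_lt (c + p) Q_gt0; lia.
apply: sum_pred_le1 => a b /eqP ha /eqP hb; apply: val_inj => /=.
have h1 := add_gap (c + a) Q_gt0; have h2 := add_gap (c + b) Q_gt0.
have la := ltn_ord a; have lb := ltn_ord b.
rewrite ha in h1; rewrite hb in h2.
have : level Q (c + a) = level Q (c + b).
  apply/eqP; rewrite eqn_leq; apply/andP; split; rewrite leqNgt; apply/negP => h; nia.
by nia.
Qed.

(** A solution (p, r) with r >= y moves to the solution (p, r - y) for g; each of the y values r < y
    leaves at most one p. *)
Lemma count_pair_shift e g y :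
  \sum_(p < Q) \sum_(r < Q) (p + r + e == g + y)
    <= \sum_(p < Q) \sum_(r < Q) (p + r + e == g) + y.
Proof.
have split_r p : \sum_(r < Q) (p + r + e == g + y) <=
  \sum_(r < Q) (p + r + e == g) + \sum_(r < y) (p + r + e == g + y).
  rewrite -!(big_mkord xpredT (fun r => nat_of_bool (p + r + e == _))).
  case: (leqP Q y) => hy.
    rewrite (@big_cat_nat _ _ _ Q 0 y)//= addnCA leq_addr//.
  rewrite (@big_cat_nat _ _ _ y 0 Q)//=; last lia.
  rewrite addnC leq_add2r -{1}(add0n y) big_addn.
  rewrite (@big_cat_nat _ _ _ (Q - y) 0 Q)//=; last lia.
  apply: leq_trans (leq_addr _ _); apply: leq_sum => r _; lia.
apply: leq_trans; first by apply: leq_sum => p _; exact: split_r.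
rewrite big_split/= leq_add2l exchange_big/=.
rewrite -[X in _ <= X]card_ord -sum1_card; apply: leq_sum => r _.
by apply: sum_pred_le1 => a b /eqP ha /eqP hb; apply: val_inj => /=; lia.
Qed.

(* In each of the 2L+1 central blocks, moving the target of p + r by y creates at
   most y new solutions, by [count_pair_shift]. *)
Lemma count_lead_le y c a : L <= s ->
  \sum_(p < Q) \sum_(r < Q) (lead s L y Q (c + p + r) == a) <= Q + L.*2.+1 * y.
Proof.
move=> Ls.
have count_gap g : \sum_(p < Q) \sum_(r < Q) (gap Q (c + p + r) == g) <= Q * (g < Q).
  apply: (@leq_trans (\sum_(p < Q) (g < Q))); last by rewrite sum_nat_const card_ord.
  by apply: leq_sum => p _; exact: count_gap_le.
pose cen t := central s L (level Q t).
(* Central solutions are sorted by their level s - L + i, which turns the condition on [gap] into a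
   linear equation in p and r. *)
have count_central g : g < Q ->
    \sum_(p < Q) \sum_(r < Q) ((gap Q (c + p + r) == g) && cen (c + p + r)) =
    \sum_(i < L.*2.+1) \sum_(p < Q) \sum_(r < Q) (p + r + (c + g) == (s - L + i) * Q).
  move=> gQ; rewrite [RHS]exchange_big/=; apply: eq_bigr => p _.
  rewrite [RHS]exchange_big/=; apply: eq_bigr => r _.
  have [/eqP hg|hg] := boolP (gap Q (c + p + r) == g); last first.
    rewrite big1// => i _; apply/eqP; rewrite eqb0; apply: contra hg => /eqP h.
    have [|-> _] := @gap_level_uniq Q (c + p + r) g (s - L + i) gQ _; last by [].
    by rewrite -h; lia.
  have h := add_gap (c + p + r) Q_gt0; rewrite hg in h.
  rewrite andTb; have [hc|hc] := boolP (cen _).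
    have hi : level Q (c + p + r) - (s - L) < L.*2.+1.
      by move: hc; rewrite /cen /central; lia.
    rewrite (bigD1 (Ordinal hi))//= big1 ?addn0.
      have -> : s - L + (level Q (c + p + r) - (s - L)) = level Q (c + p + r).
        by move: hc; rewrite /cen /central; lia.
      by rewrite -h; lia.
    move=> i; rewrite -val_eqE/= => hne; apply/eqP; rewrite eqb0; apply: contra hne => /eqP h'.
    have [|_ hl] := @gap_level_uniq Q (c + p + r) g (s - L + i) gQ _; last by lia.
    by rewrite -h'; lia.
  rewrite big1// => i _; apply/eqP; rewrite eqb0; apply: contra hc => /eqP h'.
  have [|_ hl] := @gap_level_uniq Q (c + p + r) g (s - L + i) gQ _.
    by rewrite -h'; lia.
  by rewrite /cen hl /central; have := ltn_ord i; lia.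
(* For a >= Q only shifted leads reach a; their gap is a - y, so the plain bound Q suffices. *)
have [aQ|Qa] := ltnP a Q; last first.
  apply: (@leq_trans (\sum_(p < Q) \sum_(r < Q) (gap Q (c + p + r) == a - y))).
    apply: leq_sum => p _; apply: leq_sum => r _; rewrite /lead.
    by have := gap_lt (c + p + r) Q_gt0; case: ifP => _; lia.
  apply: leq_trans (count_gap _) _; apply: leq_trans (leq_addr _ _).
  by case: (_ < _); lia.
(* To avoid subtraction, the central solutions of gap = a, which the shift moves away, are added to
   both sides. *)
suff: \sum_(p < Q) \sum_(r < Q) (lead s L y Q (c + p + r) == a) +
      \sum_(p < Q) \sum_(r < Q) ((gap Q (c + p + r) == a) && cen (c + p + r)) <=
      Q + (\sum_(p < Q) \sum_(r < Q) ((gap Q (c + p + r) == a) && cen (c + p + r)) +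
      L.*2.+1 * y) by lia.
apply: (@leq_trans (\sum_(p < Q) \sum_(r < Q) (gap Q (c + p + r) == a) +
   \sum_(p < Q) \sum_(r < Q) ((gap Q (c + p + r) + y == a) && cen (c + p + r)))).
  rewrite -!big_split/=; apply: leq_sum => p _; rewrite -!big_split/=.
  apply: leq_sum => r _; rewrite /lead /cen.
  by case: central; rewrite ?andbF ?addn0 ?andbT// addnC.
apply: leq_add; first by have := count_gap a; rewrite aQ muln1.
have [ya|ay] := leqP y a; last first.
  rewrite big1// => p _; rewrite big1// => r _; apply/eqP; rewrite eqb0; lia.
rewrite (eq_bigr (fun p : 'I_Q => \sum_(r < Q)
    ((gap Q (c + p + r) == a - y) && cen (c + p + r)))); last first.
  move=> p _; apply: eq_bigr => r _; congr (nat_of_bool (_ && _)); lia.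
rewrite !count_central//; last lia.
rewrite -[L.*2.+1 * y](_ : \sum_(i < L.*2.+1) y = _); last first.
  by rewrite sum_nat_const card_ord.
rewrite -big_split/=; apply: leq_sum => i _.
have := count_pair_shift (c + a) ((s - L + i) * Q) y.
apply: leq_trans; apply: leq_sum => p _; apply: leq_sum => r _.
by rewrite -(eqn_add2r y); lia.
Qed.

(** A lead of at least Q needs one of the y largest gaps, and each gap occurs at most once. *)
Lemma count_lead_ge y c : \sum_(p < Q) (Q <= lead s L y Q (c + p)) <= y.
Proof.
apply: (@leq_trans (\sum_(p < Q) \sum_(g < y) (gap Q (c + p) == Q - y + g))).
  apply: leq_sum => p _; case: (leqP Q _) => // h.
  have := gap_lt (c + p) Q_gt0 => hg.
  have hy : gap Q (c + p) - (Q - y) < y by move: h; rewrite /lead; case: ifP; lia.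
  rewrite (bigD1 (Ordinal hy))//= [X in nat_of_bool X](_ : _ = true)//.
  by move: h; rewrite /lead; case: ifP; lia.
rewrite exchange_big/= -[X in _ <= X]card_ord -sum1_card.
apply: leq_sum => g _; apply: leq_trans (count_gap_le _ _) _; exact: leq_b1.
Qed.
End Counting.

(** * Uniform points of the cube: resampling, variance and collisions *)

Section Resample.
Variables (I T : finType).
Implicit Types (x : {ffun I -> T}) (F : {ffun I -> T} -> nat).

Definition upd x (u : I) (p : T) : {ffun I -> T} :=
  [ffun k => if k == u then p else x k].

Lemma updE x u p k : upd x u p k = if k == u then p else x k.
Proof. by rewrite ffunE. Qed.

(** Exchanging a fresh value with the coordinate u is an involution on pairs, so resampling
    preserves the uniform distribution. *)
Lemma sum_resample F u :
  \sum_x \sum_p F (upd x u p) = #|T| * \sum_x F x.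
Proof.
pose h (z : {ffun I -> T} * T) := (upd z.1 u z.2, z.1 u).
have hK : involutive h.
  move=> [x p]; rewrite /h /= updE eqxx; congr pair; apply/ffunP => k.
  by rewrite !updE; case: eqP => // ->.
rewrite pair_big/= (reindex_inj (inv_inj hK))/=.
rewrite -(pair_big xpredT xpredT (fun x p => F (upd (upd x u p) u (x u))))/=.
rewrite big_distrr/=; apply: eq_bigr => x _.
rewrite (eq_bigr (fun=> F x)) ?sum_nat_const// => p _; congr F.
by apply/ffunP => k; rewrite !updE; case: eqP => // ->.
Qed.
End Resample.

Section Cube.
Variables (s Q' : nat).
Let Q := Q'.+1.
Let coord := ('I_s * bool * bool)%type.
Let cube := {ffun coord -> 'I_Q}.
Implicit Types (f g : {ffun 'I_s -> bool}) (x : cube).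

(* Every selected coordinate comes in two copies, so that for f != g at least two
   coordinates contribute to [hsum f] and not to [hsum g]. *)
Definition hsum f x : nat := \sum_(i < s) \sum_b x (i, b, f i).

Lemma hsum_upd f x i b p :
  hsum f (upd x (i, b, f i) p) + x (i, b, f i) = hsum f x + p.
Proof.
rewrite /hsum (bigD1 i)//= (bigD1 b)//= [in RHS](bigD1 i)//= [in RHS](bigD1 b)//=.
rewrite updE eqxx.
rewrite (eq_bigr (fun b => nat_of_ord (x (i, b, f i)))); last first.
  by move=> b' hb; rewrite updE !xpair_eqE (negbTE hb) andbF.
rewrite [X in _ + _ + X + _](eq_bigr (fun i => \sum_b nat_of_ord (x (i, b, f i)))); last first.
  move=> j hj; apply: eq_bigr => b' _; rewrite updE !xpair_eqE (negbTE hj)//.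
by rewrite [LHS]addnC -!addnA; congr (_ + _); rewrite addnC -!addnA.
Qed.

Lemma hsum_upd_notin f x i b v p : v != f i ->
  hsum f (upd x (i, b, v) p) = hsum f x.
Proof.
move=> vf; apply: eq_bigr => j _; apply: eq_bigr => b' _; rewrite updE !xpair_eqE.
by case: eqP => //= ->; rewrite [f i == v]eq_sym (negbTE vf) andbF.
Qed.

Variable L : nat.

(** One selected coordinate is resampled with the others fixed, which reduces the claim to
    [count_lead_ge]. *)
Lemma card_lead_overflow f y : 0 < s ->
  Q * \sum_x (Q <= lead s L y Q (hsum f x)) <= #|cube| * y.
Proof.
move=> s0; pose i := Ordinal s0; pose u := (i, false, f i).
rewrite -{1}[Q]card_ord -(sum_resample
  (fun x : cube => nat_of_bool (Q <= lead s L y Q (hsum f x))) u).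
rewrite -sum_nat_const; apply: leq_sum => x _.
apply: leq_trans (@count_lead_ge Q s L isT y (hsum f (upd x u ord0))).
apply: leq_sum => p _.
have h1 := hsum_upd f x i false p; have h2 := hsum_upd f x i false ord0.
by rewrite /= -/u in h1 h2; have -> : hsum f (upd x u p) = hsum f (upd x u ord0) + p by lia.
Qed.

Section Chebyshev.
Local Open Scope ring_scope.

(** Twice the centred coordinate, to stay in the integers. *)
Let z x k : int := (x k : nat)%:Z *+ 2 - Q'%:Z.

(** Reflecting the coordinate k negates one factor only, so the sum equals its own negative. *)
Let sum_zz k l : k != l -> \sum_x z x k * z x l = 0.
Proof.
move=> kl; pose h x := upd x k (rev_ord (x k)).
have hK : involutive h.
  move=> x; apply/ffunP => j; rewrite !updE eqxx rev_ordK.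
  by case: eqP => // ->.
suff : \sum_x z x k * z x l = - \sum_x z x k * z x l by lia.
rewrite {1}(reindex_inj (inv_inj hK)) -sumrN; apply: eq_bigr => x _.
rewrite /z /h !updE eqxx eq_sym (negbTE kl) /=.
have := ltn_ord (x k); rewrite ltnS => hk; rewrite subSS.
rewrite (_ : (Q' - x k)%N%:Z = Q'%:Z - (x k)%:Z); last by lia.
ring.
Qed.

Let z_le x k : z x k ^+ 2 <= Q%:Z ^+ 2.
Proof. by have := ltn_ord (x k); rewrite /z /Q; nia. Qed.

(** The mean of [hsum] is s Q'. The 2s selected coordinates are uncorrelated, so only the diagonal
    terms survive, each at most Q^2. *)
Lemma second_moment_hsum f :
  \sum_x ((hsum f x)%:Z *+ 2 - (s * Q')%N%:Z *+ 2) ^+ 2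
    <= (#|cube| * s.*2 * Q ^ 2)%N%:Z.
Proof.
have e x : (hsum f x)%:Z *+ 2 - (s * Q')%N%:Z *+ 2 = \sum_(p : 'I_s * bool) z x (p.1, p.2, f p.1).
  rewrite /hsum pair_bigA/= /z sumrB sumrMnl; congr (_ *+ _ - _).
    by rewrite (big_morph Posz PoszD (erefl _)).
  by rewrite sumr_const card_prod card_ord card_bool; lia.
under eq_bigr do rewrite e expr2 big_distrlr/=.
rewrite exchange_big/= (_ : _%:Z = \sum_(p : 'I_s * bool) \sum_(x : cube) Q%:Z ^+ 2); last first.
  rewrite !sumr_const card_prod card_ord card_bool -mulrnA -mulr_natr natz.
  by rewrite expr2 -!PoszM muln2 mulnC [X in (_ * X)%N]mulnC.
apply: ler_sum => p _; rewrite exchange_big/= (bigD1 p)//= [X in _ + X <= _]big1 ?addr0.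
  by apply: ler_sum => x _; rewrite -expr2.
move=> q qp; apply: sum_zz; apply: contra qp; case: p q => [i b] [j c]/=.
by rewrite !xpair_eqE => /andP[/andP[/eqP -> /eqP ->] _]; rewrite !eqxx.
Qed.

Lemma card_noncentral f : (s <= Q)%N ->
  (2 * L ^ 2 * \sum_x ~~ central s L (level Q (hsum f x)) <= #|cube| * s)%N.
Proof.
move=> sQ.
suff : ((2 * Q ^ 2) * (2 * L ^ 2 * \sum_x ~~ central s L (level Q (hsum f x))) <=
   (2 * Q ^ 2) * (#|cube| * s))%N by rewrite leq_pmul2l.
suff : ((2 * Q * L) ^ 2 * \sum_x ~~ central s L (level Q (hsum f x)))%N%:Z <=
   (#|cube| * s.*2 * Q ^ 2)%N%:Z by lia.
apply: le_trans (second_moment_hsum f).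
rewrite PoszM (big_morph Posz PoszD (erefl _)) mulr_sumr; apply: ler_sum => x _.
case: (boolP (central _ _ _)) => /= hc; first by rewrite mulr0 sqr_ge0.
have h1 := @add_gap Q (hsum f x) isT; have h2 := @gap_lt Q (hsum f x) isT.
move: hc; rewrite /central negb_and -!ltnNge => hc.
rewrite mulr1; set t := hsum f x in h1 h2 hc *; set j := level Q t in h1 h2 hc *.
(* The mean is s (Q - 1) rather than s Q; in the lower tail the discrepancy s is absorbed by one
   block, as s <= Q. *)
have : (t%:Z *+ 2 - (s * Q')%N%:Z *+ 2 >= (2 * Q * L)%N%:Z) \/
    (t%:Z *+ 2 - (s * Q')%N%:Z *+ 2 <= - (2 * Q * L)%N%:Z).
  rewrite /Q in h1 h2 sQ *; move: h1 h2 hc; set g := gap _ t; clearbody g j t.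
  move=> h1 h2 /orP[] hc.
    right; have : ((j + L + 1) * Q'.+1 <= s * Q'.+1)%N by rewrite leq_mul2r; apply/orP; right; lia.
    lia.
  left; have : ((s + L + 1) * Q'.+1 <= j * Q'.+1)%N by rewrite leq_mul2r; apply/orP; right; lia.
  lia.
have -> : ((2 * Q * L) ^ 2)%N%:Z = (2 * Q * L)%N%:Z ^+ 2 by rewrite -mulnn PoszM expr2.
by case=> h; [|rewrite -[leRHS]sqrrN]; rewrite lerXn2r ?nnegrE//; lia.
Qed.
End Chebyshev.

Hypothesis Ls : L <= s.

(** Where f and g differ, the two copies selected by f are ignored by g. Resampling both keeps the
    lead of g fixed, so [count_lead_le] applies. *)
Lemma card_lead_collide f g y : f != g ->
  Q ^ 2 * \sum_x (lead s L y Q (hsum f x) == lead s L y Q (hsum g x))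
    <= #|cube| * (Q + L.*2.+1 * y).
Proof.
move=> fg; have [i fgi] : exists i, f i != g i.
  by apply/existsP; apply: contraNT fg; rewrite negb_exists => /forallP h;
     apply/eqP/ffunP => i; apply/eqP; have := h i; rewrite negbK.
set F := fun x : cube => nat_of_bool (lead s L y Q (hsum f x) == lead s L y Q (hsum g x)).
pose u := (i, false, f i); pose v := (i, true, f i).
have -> : Q ^ 2 * \sum_x F x = \sum_x \sum_p \sum_r F (upd (upd x u p) v r).
  rewrite expnS expn1 -mulnA -{2}[Q]card_ord -(sum_resample F v).
  rewrite -{1}[Q]card_ord -(sum_resample (fun x => \sum_r F (upd x v r)) u)//.
rewrite -sum_nat_const; apply: leq_sum => x _.
pose c := hsum f (upd (upd x u ord0) v ord0).
have hc p r : hsum f (upd (upd x u p) v r) = c + p + r.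
  have h1 := hsum_upd f (upd x u p) i true r.
  have h2 := hsum_upd f x i false p.
  have h3 := hsum_upd f (upd x u ord0) i true ord0.
  have h4 := hsum_upd f x i false ord0.
  have e q : upd x u q v = x v by rewrite updE !xpair_eqE andbF.
  rewrite -/u -/v /= ?e in h1 h2 h3 h4.
  by rewrite /c /=; lia.
apply: leq_trans (@count_lead_le Q s L isT y c (lead s L y Q (hsum g x)) Ls).
apply: leq_sum => p _; apply: leq_sum => r _.
by rewrite /F hc !hsum_upd_notin.
Qed.
End Cube.

Local Open Scope classical_set_scope.
Local Open Scope ring_scope.

(** * Second moment bound on the number of secrets that a query detects *)

Section SecondMoment.
Variables (R : realFieldType) (Omega Phi : finType) (N Q e e' : nat).
Variables (G : Phi -> Omega -> 'I_N) (q : Omega -> 'I_N -> R) (F : {set Phi}).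
Hypothesis Q_gt0 : (0 < Q)%N.
Hypothesis QN : (Q <= N)%N.
Hypothesis Omega_gt0 : (0 < #|Omega|)%N.
Hypothesis q_le1 : forall w a, `|q w a| <= 1.
Hypothesis collide : forall f g, f != g ->
  (Q ^ 2 * \sum_w (G f w == G g w) <= #|Omega| * (Q + e))%N.
Hypothesis overflow : forall f, (Q * \sum_w (Q <= G f w) <= #|Omega| * e')%N.

(* [G f w] is the lead coordinate for the secret f; the reference distribution
   has it uniform on {0..Q-1} and independent of w. *)
Definition advantage (f : Phi) : R :=
  #|Omega|%:R^-1 * (\sum_w (q w (G f w) - Q%:R^-1 * \sum_(a < N | (a < Q)%N) q w a)).

(** The number of secrets in F with lead a at w; [c a] is its expectation under the reference
    distribution. *)
Let u w a : R := \sum_(f in F) (G f w == a)%:R.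
Let c (a : 'I_N) : R := #|F|%:R / Q%:R * (a < Q)%:R.
Let n : R := #|Omega|%:R.

Let sum_bool (P : pred 'I_N) (h : 'I_N -> R) :
  \sum_a (P a)%:R * h a = \sum_(a | P a) h a.
Proof. by rewrite [RHS]big_mkcond; apply: eq_bigr => a _; case: (P a); rewrite ?mul1r ?mul0r. Qed.

Let sum_ind (b : 'I_N) (h : 'I_N -> R) : \sum_a (b == a)%:R * h a = h b.
Proof. by rewrite sum_bool (eq_bigl (pred1 b)) ?big_pred1_eq// => a; rewrite /= eq_sym. Qed.

Let card_lt_Q : \sum_(a < N) (a < Q)%:R = Q%:R :> R.
Proof.
under eq_bigr do rewrite -[_%:R]mulr1.
by rewrite sum_bool -(big_ord_widen N (fun=> 1)) // sumr_const card_ord.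
Qed.

Lemma sum_advantage :
  \sum_(f in F) advantage f = n^-1 * \sum_w \sum_a q w a * (u w a - c a).
Proof.
rewrite /advantage -mulr_sumr exchange_big/=; congr (_ * _); apply: eq_bigr => w _.
rewrite sumrB.
under [X in _ = X]eq_bigr do rewrite mulrBr.
rewrite sumrB; congr (_ - _).
  under [RHS]eq_bigr do rewrite mulr_sumr.
  rewrite exchange_big/=; apply: eq_bigr => f _.
  by under [RHS]eq_bigr do rewrite mulrC; rewrite sum_ind.
rewrite sumr_const -[LHS]mulr_natl mulrA -sum_bool mulr_sumr; apply: eq_bigr => a _.
by rewrite /c; ring.
Qed.

(** When the square is expanded, the main terms |F|^2 / Q occur with coefficients 1, -2 and 1 and
    cancel. What remains is the diagonal |F|, the excess e of the collisions and the overflow e'. *)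
Lemma sum_deviation_sqr :
  n^-1 * \sum_w \sum_a (u w a - c a) ^+ 2
    <= #|F|%:R + #|F|%:R ^+ 2 * (e + 2 * e')%:R / Q%:R ^+ 2.
Proof.
have Q0 : (0 : R) < Q%:R by rewrite ltr0n.
have n0 : 0 < n by rewrite ltr0n.
pose phi : R := #|F|%:R.
have expand w : \sum_a (u w a - c a) ^+ 2 =
   \sum_(f in F) \sum_(g in F) (G f w == G g w)%:R
   - 2 * (phi / Q%:R) * \sum_(f in F) (1 - (Q <= G f w)%:R) + phi ^+ 2 / Q%:R.
  under eq_bigr do rewrite sqrrB.
  rewrite big_split/= sumrB; congr (_ - _ + _).
  - rewrite (eq_bigr (fun a => \sum_(f in F) (G f w == a)%:R * u w a)); last first.
      by move=> a _; rewrite expr2 {1}/u mulr_suml.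
    rewrite exchange_big/=; apply: eq_bigr => f _.
    by rewrite sum_ind; apply: eq_bigr => g _; rewrite eq_sym.
  - rewrite (eq_bigr (fun a => \sum_(f in F) (G f w == a)%:R * (2 * c a))); last first.
      by move=> a _; rewrite /u mulr_suml -mulr_natl mulr_sumr; apply: eq_bigr => f _; ring.
    rewrite exchange_big mulr_sumr/=; apply: eq_bigr => f _.
    by rewrite sum_ind /c ltnNge; case: leqP => _ /=; rewrite /phi; ring.
  - rewrite /c; under eq_bigr do rewrite exprMn -natrX.
    rewrite -mulr_sumr.
    have -> : \sum_(a < N) ((a < Q) ^ 2)%:R = Q%:R :> R.
      by rewrite -card_lt_Q; apply: eq_bigr => a _; case: (_ < _)%N.
    by rewrite /phi; field; rewrite gt_eqF.
under eq_bigr do rewrite expand.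
have -> : n^-1 * \sum_w (\sum_(f in F) \sum_(g in F) (G f w == G g w)%:R
     - 2 * (phi / Q%:R) * \sum_(f in F) (1 - (Q <= G f w)%:R) + phi ^+ 2 / Q%:R) =
   n^-1 * \sum_(f in F) \sum_w \sum_(g in F) (G f w == G g w)%:R
   - 2 * (phi / Q%:R) * (n^-1 * \sum_(f in F) \sum_w (1 - (Q <= G f w)%:R))
   + phi ^+ 2 / Q%:R.
  rewrite [in RHS]exchange_big/= [X in _ - _ * (_ * X)]exchange_big/=.
  rewrite big_split sumrB/= -mulr_sumr sumr_const -[_ *+ #|_|]mulr_natl -/n.
  by field; rewrite !gt_eqF.
have pairs : n^-1 * \sum_(f in F) \sum_w \sum_(g in F) (G f w == G g w)%:R <=
    phi + phi ^+ 2 * (Q + e)%:R / Q%:R ^+ 2.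
  have pair f g : f != g -> n^-1 * \sum_w (G f w == G g w)%:R <= (Q + e)%:R / Q%:R ^+ 2.
    move=> fg; rewrite ler_pdivlMr ?exprn_gt0// -mulrA ler_pdivrMl// mulrC.
    by rewrite -natr_sum -natrX -!natrM ler_nat; exact: collide.
  rewrite mulr_sumr.
  have one f : f \in F -> n^-1 * \sum_w \sum_(g in F) (G f w == G g w)%:R <=
     1 + phi * ((Q + e)%:R / Q%:R ^+ 2).
    move=> fF; rewrite exchange_big/= (bigD1 f)//= mulrDr.
    apply: lerD.
      by under eq_bigr do rewrite eqxx; rewrite sumr_const -/n mulVf// gt_eqF.
    rewrite mulr_sumr.
    apply: (@le_trans _ _ (\sum_(g in F) (Q + e)%:R / Q%:R ^+ 2)).
      rewrite [leRHS](bigD1 f)//= -[leLHS]add0r; apply: lerD.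
        by rewrite divr_ge0 ?exprn_ge0// ?ler0n.
      by apply: ler_sum => g /andP[_ gf]; apply: pair; rewrite eq_sym.
    by rewrite sumr_const -[leLHS]mulr_natl.
  apply: le_trans; first by apply: ler_sum => f fF; exact: one.
  by rewrite sumr_const -mulr_natl -/phi; rewrite le_eqVlt; apply/orP; left; apply/eqP; ring.
have over : n^-1 * \sum_(f in F) \sum_w (1 - (Q <= G f w)%:R) >= phi - phi * (e'%:R / Q%:R).
  rewrite mulr_sumr.
  have one f : f \in F -> 1 - e'%:R / Q%:R <= n^-1 * \sum_w (1 - (Q <= G f w)%:R).
    move=> _; rewrite sumrB sumr_const -/n mulrBr mulVf ?gt_eqF// lerD2l lerN2.
    rewrite ler_pdivlMr// -mulrA ler_pdivrMl// mulrC.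
    by rewrite -natr_sum -!natrM ler_nat; exact: overflow.
  apply: le_trans; last by apply: ler_sum => f fF; exact: one.
  by rewrite sumr_const -mulr_natl -/phi; rewrite le_eqVlt; apply/orP; left; apply/eqP; ring.
have phi0 : 0 <= phi by exact: ler0n.
have h : 2 * (phi / Q%:R) * (phi - phi * (e'%:R / Q%:R)) <=
  2 * (phi / Q%:R) * (n^-1 * \sum_(f in F) \sum_w (1 - (Q <= G f w)%:R)).
  by rewrite ler_wpM2l// mulr_ge0// divr_ge0// ler0n.
apply: le_trans (lerD (lerB pairs h) (lexx _)) _.
rewrite le_eqVlt; apply/orP; left; apply/eqP; rewrite [(e + _)%:R]natrD natrM [(Q + e)%:R]natrD; field.
by rewrite gt_eqF.
Qed.

(** The total advantage is an inner product of q with the deviation u - c, where the square norm of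
    q is at most N for each w. *)
Lemma card_advantage_sqr tau : 0 <= tau -> (forall f, f \in F -> tau <= advantage f) ->
  (#|F|%:R * tau) ^+ 2
    <= N%:R * (#|F|%:R + #|F|%:R ^+ 2 * (e + 2 * e')%:R / Q%:R ^+ 2).
Proof.
move=> tau0 hF; have N0 : (0 : R) < N%:R by rewrite ltr0n; exact: leq_trans QN.
have n0 : 0 < n by rewrite ltr0n.
set phi : R := #|F|%:R; set V := (X in _ <= _ * X).
have h1 : phi * tau <= n^-1 * \sum_w \sum_a q w a * (u w a - c a).
  rewrite -sum_advantage; apply: le_trans; last by apply: ler_sum => f fF; exact: hF.
  by rewrite sumr_const mulr_natl.
pose k := phi * tau / N%:R.
(* AM-GM with the optimal weight k replaces the Cauchy-Schwarz inequality. *)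
have h2 : 2 * k * (n^-1 * \sum_w \sum_a q w a * (u w a - c a)) <= k ^+ 2 * N%:R + V.
  apply: (@le_trans _ _ (k ^+ 2 * N%:R + n^-1 * \sum_w \sum_a (u w a - c a) ^+ 2)); last first.
    by rewrite lerD2l; exact: sum_deviation_sqr.
  have -> : k ^+ 2 * N%:R = n^-1 * \sum_(w : Omega) \sum_(a < N) k ^+ 2.
    by rewrite !sumr_const card_ord -[_ *+ #|_|]mulr_natl -/n mulKf ?gt_eqF// mulr_natr.
  rewrite -mulrDr mulrCA ler_pM2l ?invr_gt0// -big_split mulr_sumr; apply: ler_sum => w _.
  rewrite -big_split mulr_sumr; apply: ler_sum => a _ /=.
  have := sqr_ge0 (k * q w a - (u w a - c a)).
  have : (k * q w a) ^+ 2 <= k ^+ 2.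
    rewrite exprMn ler_piMr ?sqr_ge0// -real_normK ?num_real//.
    by rewrite exprn_ile1.
  by lra.
have k0 : 0 <= k by rewrite divr_ge0 ?mulr_ge0 ?ler0n.
have h3 : 2 * k * (phi * tau) <= k ^+ 2 * N%:R + V.
  by apply: le_trans h2; rewrite ler_wpM2l// mulr_ge0.
have e1 : 2 * k * (phi * tau) = 2 * ((phi * tau) ^+ 2 / N%:R) by rewrite /k; field; rewrite gt_eqF.
have e2 : k ^+ 2 * N%:R = (phi * tau) ^+ 2 / N%:R by rewrite /k; field; rewrite gt_eqF.
rewrite e1 e2 in h3; rewrite [leRHS]mulrC -ler_pdivrMr//.
by move: h3; set W := (phi * tau) ^+ 2 / N%:R; clearbody V W; lra.
Qed.
End SecondMoment.

(** * Linear classifiers that realize polynomial scores *)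

Section Argmax.
Variables (R : realType) (m : nat).
Implicit Types (sc : 'I_m.+1 -> R).

Lemma smallest_argmax_exists sc : exists i, is_smallest_argmax sc i.
Proof.
have [i0 hi0] : exists i0, forall j, sc j <= sc i0.
  by exists [arg max_(i > ord0) sc i]%O; case: arg_maxP => // i _ h j; exact: h.
pose P := [pred i | [forall j, sc j <= sc i]].
have Pi0 : P i0 by apply/forallP.
have [i /forallP Pi hi] := arg_minnP (fun i : 'I_m.+1 => val i) Pi0.
exists i; split=> // j ji; rewrite ltNge; apply/negP => hj.
suff /hi : P j by rewrite leqNgt ji.
by apply/forallP => k; exact: le_trans (Pi k) hj.
Qed.

Lemma smallest_argmax_uniq sc i i0 :
  is_smallest_argmax sc i -> (forall j, j != i0 -> sc j < sc i0) -> i = i0.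
Proof.
move=> [hi _] h; apply: contrapT => /eqP /h; rewrite ltNge => /negP; apply; exact: hi.
Qed.
End Argmax.

Section Embedding.
Variables (R : realType) (Gamma : finType) (d : nat).
Hypothesis Gd : (#|Gamma| <= d)%N.

(** Padding with zeros lets the same construction work in every dimension d >= #|Gamma|. *)
Definition embed (c : Gamma -> R) : d.-tuple R :=
  [tuple oapp (fun i : 'I_#|Gamma| => c (enum_val i)) 0 (insub (val k)) | k < d].

Lemma dotp_embed (a b : Gamma -> R) : dotp (embed a) (embed b) = \sum_g a g * b g.
Proof.
rewrite /dotp.
pose F (k : nat) := oapp (fun i : 'I_#|Gamma| => a (enum_val i) * b (enum_val i)) 0 (insub k).
rewrite (eq_bigr (fun k : 'I_d => F k)); last first.
  by move=> k _; rewrite !tnth_mktuple /F; case: insub => [i|] //=; rewrite mul0r.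
rewrite -(big_mkord xpredT F) (big_cat_nat _ Gd)//= [X in _ + X]big_nat_cond [X in _ + X]big1 ?addr0.
  rewrite big_mkord [RHS](big_enum_val (A := Gamma) (fun g => a g * b g))/=.
  by apply: eq_bigr => i _; rewrite /F valK.
by move=> i /andP[/andP[hi _] _]; rewrite /F insubN// -leqNgt.
Qed.
End Embedding.

Section NodeClassifier.
Variables (R : realType) (d m : nat) (J Z : finType) (j0 : J).
Variables (nu : Z -> R) (lab : Z -> 'I_m.+1) (h : J -> R).
Let Gamma : finType := {ffun Z * bool -> J}.
Hypothesis Gd : (#|Gamma| <= d)%N.
Hypothesis nu_inj : injective nu.
Hypothesis lab_max : forall p, lab p != ord_max.

(* The coordinate j0 of z is meant to be the constant 1, and every node occurs
   twice among the factors because the scores are built from squares. *)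
Definition veronese (z : J -> R) : d.-tuple R :=
  embed d (fun g : Gamma => \prod_k z (g k)).

(** [Some p] leaves out both factors of the node p; [None] leaves out nothing. *)
Let node_prod (o : option Z) (t : R) : R :=
  \prod_(k : Z * bool) (if Some k.1 == o then 1 else t - nu k.1).

(** Coefficients of the k-th factor as a linear form in z. An omitted factor becomes the constant
    coordinate j0, so all products have the same degree. *)
Let factor (o : option Z) (k : Z * bool) (j : J) : R :=
  if Some k.1 == o then (j == j0)%:R else h j - (j == j0)%:R * nu k.1.

Let weight (o : option Z) (g : Gamma) : R := \prod_k factor o k (g k).

(** Distributivity expands the product of linear forms over all maps g. *)
Let weightE o (z : J -> R) : z j0 = 1 ->
  \sum_g weight o g * \prod_k z (g k) = node_prod o (\sum_j h j * z j).
Proof.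
move=> z1; under eq_bigr do rewrite -big_split/=.
rewrite -(bigA_distr_bigA (fun k j => factor o k j * z j)); apply: eq_bigr => k _.
have sum0 : \sum_j (j == j0)%:R * z j = 1.
  by rewrite (bigD1 j0)//= eqxx z1 mul1r big1 ?addr0// => j /negbTE->; rewrite mul0r.
rewrite /factor; case: ifP => // _.
under eq_bigr do rewrite mulrBl mulrAC.
by rewrite sumrB -mulr_suml sum0 mul1r.
Qed.

(* Divided by [node_prod None], the score of an ordinary label l is the sum of the
   (t - nu p)^-2 over the nodes p labelled l, and that of [ord_max] is #|Z| + 1. *)
Let score (l : 'I_m.+1) (t : R) : R :=
  \sum_(p | lab p == l) node_prod (Some p) t
  + (l == ord_max)%:R * #|Z|.+1%:R * node_prod None t.

Let score_weight (l : 'I_m.+1) : d.-tuple R := embed d (fun g =>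
  \sum_(p | lab p == l) weight (Some p) g
  + (l == ord_max)%:R * #|Z|.+1%:R * weight None g).

Let dotp_score l (z : J -> R) : z j0 = 1 ->
  dotp (score_weight l) (veronese z) = score l (\sum_j h j * z j).
Proof.
move=> z1; rewrite dotp_embed// /score -(weightE None z1) mulr_sumr.
under [X in _ = X + _]eq_bigr do rewrite -(weightE _ z1).
rewrite exchange_big -big_split/=; apply: eq_bigr => g _.
by rewrite mulrDl mulr_suml mulrA.
Qed.

Let node_prod_pair (o : option Z) t :
  node_prod o t = \prod_p (if Some p == o then 1 else (t - nu p) ^+ 2).
Proof.
rewrite /node_prod -(pair_bigA _ (fun p (b : bool) => if Some p == o then 1 else t - nu p))/=.
by apply: eq_bigr => p _; rewrite big_bool/=; case: ifP => _; rewrite ?mulr1// expr2.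
Qed.

Let node_prod_ge0 o t : 0 <= node_prod o t.
Proof.
rewrite node_prod_pair; apply: prodr_ge0 => p _.
by case: ifP => // _; exact: sqr_ge0.
Qed.

(** At the node p every product vanishes except the one that omits p. *)
Let score_node p j : j != lab p -> score j (nu p) < score (lab p) (nu p).
Proof.
move=> jp.
have vanish o : o != Some p -> node_prod o (nu p) = 0.
  move=> op; rewrite node_prod_pair (bigD1 p)//= eq_sym (negbTE op) subrr expr0n mul0r//.
have -> : score j (nu p) = 0.
  rewrite /score vanish// mulr0 addr0 big1// => q /eqP qj; apply: vanish.
  by apply: contra jp => /eqP[<-]; rewrite qj.
rewrite /score vanish// mulr0 addr0 (bigD1 p)//=.
apply: ltr_wpDr; first by apply: sumr_ge0 => q _; exact: node_prod_ge0.
rewrite node_prod_pair; apply: prodr_gt0 => q _.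
case: eqP => // qp; rewrite exprn_even_gt0//= subr_eq0.
by apply: contra_not_neq qp => /nu_inj ->.
Qed.

(** All squared factors are at least 1, so an ordinary score is at most #|Z| full products, against
    #|Z| + 1 for [ord_max]. *)
Let score_far t j : (forall p, 1 <= `|t - nu p|) -> j != ord_max ->
  score j t < score ord_max t.
Proof.
move=> ht jm.
have sq p : 1 <= (t - nu p) ^+ 2 by rewrite -real_normK ?num_real// exprn_ege1.
have bound p : node_prod (Some p) t <= node_prod None t.
  rewrite !node_prod_pair; apply: ler_prod => q _ /=.
  by case: ifP => _; rewrite ?ler01 ?sq// sqr_ge0 lexx.
have pos : 0 < node_prod None t.
  rewrite node_prod_pair; apply: prodr_gt0 => q _ /=.
  by apply: lt_le_trans (sq q).
rewrite /score (negbTE jm) !mul0r addr0 eqxx mul1r.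
rewrite [X in _ < X + _]big_pred0; last by move=> p; apply: negbTE.
rewrite add0r; apply: (@le_lt_trans _ _ (#|Z|%:R * node_prod None t)); last first.
  by rewrite ltr_pM2r// ltr_nat.
rewrite mulr_natl -sumr_const big_mkcond; apply: ler_sum => p _.
by case: ifP => _; [exact: bound | exact: ltW].
Qed.

Lemma node_classifier_exists : exists f : d.-tuple R -> 'I_m.+1,
  linear_classifier f /\ forall z : J -> R, z j0 = 1 ->
    (forall p, \sum_j h j * z j = nu p -> f (veronese z) = lab p) /\
    ((forall p, 1 <= `|\sum_j h j * z j - nu p|) -> f (veronese z) = ord_max).
Proof.
have /choice[f hf] x := smallest_argmax_exists (fun i => dotp (score_weight i) x).
exists f; split; first by exists score_weight.
move=> z z1; split=> [p tp|ht]; apply: (smallest_argmax_uniq (hf _)) => j hj;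
  rewrite !dotp_score//.
- by rewrite tp; exact: score_node.
- exact: score_far.
Qed.
End NodeClassifier.

(** * Measurability of linear classifiers, and finitely supported distributions *)

Section Measurability.
Variables (R : realType) (d m : nat).

Lemma measurable_dotp (w : d.-tuple R) : measurable_fun setT (dotp w).
Proof.
apply: measurable_sum => i; apply: measurable_funM; first exact: measurable_cst.
exact: measurable_tnth.
Qed.

Lemma measurable_linear_classifier (f : d.-tuple R -> 'I_m.+1) :
  linear_classifier f -> measurable_fun setT f.
Proof.
move=> [w hw] _ Y _; rewrite setTI.
have -> : f @^-1` Y = \bigcup_(i in Y) (f @^-1` [set i]).
  by apply/seteqP; split=> x /=; [move=> Yx; exists (f x) | move=> [i Yi /= ->]].
apply: fin_bigcup_measurable => [|i _]; first exact: finite_finset.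
have -> : f @^-1` [set i] =
    \bigcap_(j in setT) ([set x | dotp (w j) x <= dotp (w i) x] `&`
       [set x | (j < i)%N -> dotp (w j) x < dotp (w i) x]).
  apply/seteqP; split=> x /=.
    by move=> fx j _ /=; have [h1 h2] := hw x; rewrite -fx; split; [exact: h1|exact: h2].
  move=> h; have [h1 h2] := hw x; apply/val_inj/eqP; rewrite eqn_leq.
  apply/andP; split; rewrite leqNgt; apply/negP => lt.
    by have := h2 _ lt; rewrite ltNge => /negP; apply; have [] := h (f x) I.
  by have [_ /(_ lt)] := h (f x) I; rewrite ltNge => /negP; apply; exact: h1.
apply: fin_bigcap_measurable => [|j _]; first exact: finite_finset.
have mle (a b : d.-tuple R) : measurable [set x | dotp a x <= dotp b x].
  by rewrite -[X in measurable X]setTI; apply: measurable_fun_le => //; exact: measurable_dotp.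
apply: measurableI; first exact: mle.
case: (ltnP j i) => ji; last by rewrite (_ : [set _ | _] = setT)//; apply/seteqP; split.
rewrite (_ : [set _ | _] = ~` [set x | dotp (w i) x <= dotp (w j) x]).
  by apply: measurableC; exact: mle.
apply/seteqP; split=> x /=; first by move=> /(_ isT); rewrite ltNge => /negP.
by move=> /negP; rewrite -ltNge.
Qed.
End Measurability.

Section DiscreteProbability.
Context d (T : measurableType d) (R : realType) (I : finType).
Variables (c : I -> R) (p : I -> T).
Hypothesis c_ge0 : forall i, 0 <= c i.
Hypothesis c_sum1 : \sum_i c i = 1.

Let i0 : I.
Proof.
have /card_gt0P/sigW[i _]// : (0 < #|I|)%N.
rewrite lt0n; apply/eqP => /card0_eq I0.
by move: c_sum1; rewrite big1 => [/esym/eqP|i]; [rewrite oner_eq0|have := I0 i; rewrite inE].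
Qed.

(** [msum] is indexed by natural numbers, so I is enumerated; the default [i0] is never reached
    below #|I|. *)
Let atom (k : nat) := nth i0 (enum I) k.
Let dirac_part (k : nat) : {measure set T -> \bar R} :=
  mscale (NngNum (c_ge0 (atom k))) (\d_(p (atom k))).
Let mu : {measure set T -> \bar R} := msum dirac_part #|I|.

Let sum_atom (V : nmodType) (F : I -> V) : \sum_(k < #|I|) F (atom k) = \sum_i F i.
Proof.
by rewrite -(big_mkord xpredT (F \o atom)) cardE -(big_nth i0 xpredT F) big_enum.
Qed.

Let muE A : mu A = (\sum_i c i * \1_A (p i))%:E.
Proof.
rewrite /mu /= /msum/= -sumEFin.
by rewrite (sum_atom (fun i => (c i * \1_A (p i))%:E)).
Qed.

Let mu_setT : mu setT = 1%E.
Proof.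
by rewrite muE; congr EFin; rewrite -c_sum1; apply: eq_bigr => i _; rewrite indicT mulr1.
Qed.

Let ge0_integral_mu (A : set T) (g : T -> \bar R) : measurable A -> measurable_fun setT g ->
  (forall x, 0 <= g x)%E -> (\int[mu]_(x in A) g x = \sum_i (c i * \1_A (p i))%:E * g (p i))%E.
Proof.
move=> mA mg g0; have mgA : measurable_fun A g by exact: measurable_funTS.
rewrite ge0_integral_measure_sum// -(sum_atom (fun i => (c i * \1_A (p i))%:E * g (p i))%E).
by apply: eq_bigr => k _; rewrite ge0_integral_mscale// integral_dirac// muleA.
Qed.

Let integral_mu (A : set T) (g : T -> R) : measurable A -> measurable_fun setT g ->
  (\int[mu]_(x in A) (g x)%:E = (\sum_i c i * \1_A (p i) * g (p i))%:E)%E.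
Proof.
move=> mA mg; have mEg : measurable_fun setT (EFin \o g) by exact/measurable_EFinP.
rewrite integralE !ge0_integral_mu//; last 2 first.
- exact: measurable_funeneg.
- exact: measurable_funepos.
have part (h : T -> R) : (\sum_i (c i * \1_A (p i))%:E * (h (p i))%:E)%E =
    (\sum_i c i * \1_A (p i) * h (p i))%:E.
  by rewrite -sumEFin; apply: eq_bigr => i _; rewrite EFinM.
rewrite (eq_bigr (fun i => (c i * \1_A (p i))%:E * (Num.max (g (p i)) 0)%:E))%E; last first.
  by move=> i _; rewrite funeposE /= EFin_max.
rewrite [X in (_ - X)%E](eq_bigr (fun i => (c i * \1_A (p i))%:E * (Num.max (- g (p i)) 0)%:E))%E; last first.
  by move=> i _; rewrite funenegE /= EFin_max.
rewrite (part (fun x => Num.max (g x) 0)) (part (fun x => Num.max (- g x) 0)) -EFinB -sumrB.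
congr EFin; apply: eq_bigr => i _; rewrite -mulrBr; congr (_ * _).
by rewrite /Num.max; case: ifP; case: ifP; lra.
Qed.

Lemma discrete_probability_exists : exists D : probability T R,
  (forall A, D A = (\sum_i c i * \1_A (p i))%:E) /\
  (forall (A : set T) (g : T -> R), measurable A -> measurable_fun setT g ->
    (\int[D]_(x in A) (g x)%:E = (\sum_i c i * \1_A (p i) * g (p i))%:E)%E).
Proof.
exists (HB.pack_for (probability T R) (mu : set T -> \bar R) mu
  (Measure_isProbability.Build _ _ _ (mu : set T -> \bar R) mu_setT)).
split; [exact: muE | exact: integral_mu].
Qed.
End DiscreteProbability.

(** * The noise matrix and the instance hidden by a secret *)

Definition star_noise (R : realType) (K : nat) (beta : R) : 'M[R]_K.+1 :=
  \matrix_(i, j) if j == ord_max then beta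
    else if i == ord_max then (1 - beta) / K%:R else (1 - beta) * (i == j)%:R.

Lemma natr_dist_ge1 (R : realDomainType) (a b : nat) :
  a != b -> 1 <= `|a%:R - b%:R : R|.
Proof.
wlog ab : a b / (a < b)%N => [hw ne|_].
  by case: (ltngtP a b) (ne) => [/hw|/hw|->]; rewrite ?eqxx// => h _; [exact: h|rewrite distrC h// eq_sym].
by rewrite distrC -natrB 1?ltnW// normr_nat ler1n subn_gt0.
Qed.

Section HiddenInstance.
Variables (R : realType) (K s Q' L d : nat) (beta : R).
Let Q := Q'.+1.
Let coord : finType := ('I_s * bool * bool)%type.
Let cube : finType := {ffun coord -> 'I_Q}.
Let J : finType := option (option coord).
Let Z : finType := ('I_L.*2.+1 * 'I_K)%type.
Let Omega : finType := (cube * 'I_K)%type.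
Let point := d.-tuple R.
Let H := star_noise K beta.
Implicit Types (f : {ffun 'I_s -> bool}) (x : cube) (w : Omega)
  (phi : point * 'I_K.+1 -> R).

Hypothesis K_gt0 : (0 < K)%N.
Hypothesis KQ : (K <= Q)%N.
Hypothesis Ls : (L <= s)%N.
Hypothesis fits : (#|{: {ffun Z * bool -> J}}| <= d)%N.
Hypothesis beta_itv : 0 <= beta <= 1 / 2.

Definition lbl (y : 'I_K) : 'I_K.+1 := widen_ord (leqnSn K) y.

Lemma lbl_neq_max y : lbl y != ord_max.
Proof. by rewrite -val_eqE /= neq_ltn ltn_ord. Qed.

(* [None] is the constant 1 and [Some None] the lead coordinate. *)
Definition inputs x (a : nat) (j : J) : R :=
  match j with
  | None => 1
  | Some None => a%:R
  | Some (Some k) => (x k)%:R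
  end.

Definition example x a : point := veronese d Z (inputs x a).

Definition slope f (j : J) : R :=
  match j with
  | None => 0
  | Some None => 1
  | Some (Some k) => (k.2 == f k.1.1)%:R
  end.

Let sum_option (A : finType) (F : option A -> R) :
  \sum_o F o = F None + \sum_a F (Some a).
Proof.
rewrite (bigD1 None)//= (reindex_omap Some id)/=; last by case.
by congr (_ + _); apply: eq_bigl => a; rewrite eqxx.
Qed.

Lemma slope_inputs f x a : \sum_j slope f j * inputs x a j = (a + hsum f x)%:R.
Proof.
rewrite !sum_option /= mul0r add0r mul1r natrD; congr (_ + _).
transitivity (\sum_(i < s) \sum_b \sum_v (v == f i)%:R * (x (i, b, v))%:R : R).
  by rewrite !pair_bigA/=; apply: eq_bigr => -[[i b] v].
rewrite /hsum natr_sum; apply: eq_bigr => i _; rewrite natr_sum; apply: eq_bigr => b _.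
rewrite (bigD1 (f i))//= eqxx mul1r big1 ?addr0// => v /negbTE->; exact: mul0r.
Qed.

Definition node (p : Z) : R := ((s - L + p.1) * Q + p.2)%:R.

Lemma node_inj : injective node.
Proof.
move=> [j i] [j' i'] /eqP; rewrite /node eqr_nat/= => /eqP e.
have := ltn_ord i; have := ltn_ord i'; move=> h h'.
have hj : (s - L + j = s - L + j')%N by nia.
by congr pair; apply: val_inj => /=; [lia | nia].
Qed.

(** On a central example x_0 + t is the node of its level and y. Otherwise it is a multiple of Q
    outside the blocks, hence an integer different from every node, since labels are below K <=
    Q. *)
Lemma target_exists f : exists g : point -> 'I_K.+1, linear_classifier g /\
  forall x (y : 'I_K), g (example x (lead s L y Q (hsum f x))) =
    if central s L (level Q (hsum f x)) then lbl y else ord_max.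
Proof.
have [g [lin_g hg]] := @node_classifier_exists R d K J Z None node (fun p => lbl p.2)
  (slope f) fits node_inj (fun p => lbl_neq_max p.2).
exists g; split=> // x y.
have [node_g far_g] := hg (inputs x (lead s L y Q (hsum f x))) erefl.
have hl := @add_gap Q (hsum f x) isT; rewrite addnC in hl.
case: ifP => hc.
- have hj : (level Q (hsum f x) - (s - L) < L.*2.+1)%N by move: hc; rewrite /central; lia.
  apply: (node_g (Ordinal hj, y)); rewrite slope_inputs /lead hc /node/=; congr _%:R.
  rewrite addnAC hl; congr (_ * _ + _)%N; move: hc; rewrite /central; lia.
- apply: far_g => -[j i]; rewrite slope_inputs /lead hc addn0 hl /node/=.
  apply: natr_dist_ge1; apply/eqP.
  have := ltn_ord i; have := ltn_ord j; move: hc; rewrite /central /= => hc hj hi.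
  set l := level _ _ in hc *.
  have : (l < s - L \/ s + L < l)%N by lia.
  case=> hl'; nia.
Qed.

(** Expectation over the label noise. It also serves noncentral examples, where y is not the class
    but the random label drawn from the row of [ord_max]. *)
Definition mix phi (v : point) (y : 'I_K) : R :=
  (1 - beta) * phi (v, lbl y) + beta * phi (v, ord_max).

Definition mean f phi : R :=
  #|Omega|%:R^-1 * \sum_(w : Omega) mix phi (example w.1 (lead s L w.2 Q (hsum f w.1))) w.2.

Definition mistake (h : point -> 'I_K.+1) (z : point * 'I_K.+1) : R := (h z.1 != z.2)%:R.

Definition noncentral_rate f : R :=
  #|cube|%:R^-1 * \sum_(x : cube) (~~ central s L (level Q (hsum f x)))%:R.

Let Omega_gt0 : (0 : R) < #|Omega|%:R.
Proof.
rewrite ltr0n card_prod card_ord muln_gt0 K_gt0 andbT.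
by apply/card_gt0P; exists [ffun=> ord0].
Qed.

Let cell f (wb : Omega * bool) : point * 'I_K.+1 :=
  (example wb.1.1 (lead s L wb.1.2 Q (hsum f wb.1.1)), if wb.2 then ord_max else lbl wb.1.2).

Let mass (wb : Omega * bool) : R := #|Omega|%:R^-1 * (if wb.2 then beta else 1 - beta).

Let mass_ge0 wb : 0 <= mass wb.
Proof.
by rewrite mulr_ge0 ?invr_ge0 ?(ltW Omega_gt0)//; case: ifP => _; move: beta_itv; lra.
Qed.

Let mass_sum1 : \sum_wb mass wb = 1.
Proof.
rewrite -(pair_bigA _ (fun w (b : bool) => mass (w, b)))/=.
under eq_bigr do rewrite big_bool/= -mulrDr addrC subrK mulr1.
by rewrite sumr_const -[LHS]mulr_natr mulVf// gt_eqF.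
Qed.

Let mass_mean f phi : \sum_wb mass wb * phi (cell f wb) = mean f phi.
Proof.
rewrite -(pair_bigA _ (fun w (b : bool) => mass (w, b) * phi (cell f (w, b))))/=.
rewrite /mean mulr_sumr; apply: eq_bigr => w _.
by rewrite big_bool /mass /mix /cell/= -!mulrA -mulrDr addrC.
Qed.

Let meanE f phi : mean f phi = #|Omega|%:R^-1 *
  \sum_(x : cube) \sum_(y < K) mix phi (example x (lead s L y Q (hsum f x))) y.
Proof. by rewrite pair_bigA. Qed.

(** The label [ord_max] appears with probability beta <= 1/2 independently of the example, so every
    hypothesis errs with probability at least beta. The target errs with probability beta on central
    examples, and elsewhere an extra 1 is charged. *)
Lemma hidden_instance f : exists D (g : point -> 'I_K.+1),
  [/\ rcn_instance H D g,
      forall q : {mfun (point * 'I_K.+1)%type >-> R}, ('E_D[q] = (mean f q)%:E)%E,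
      forall h, err D h = mean f (mistake h),
      beta <= opt D &
      opt D <= beta + noncentral_rate f].
Proof.
have [g [lin_g gE]] := target_exists f.
have [D [DE intDE]] := discrete_probability_exists (cell f) mass_ge0 mass_sum1.
have [D' [D'E intD'E]] := discrete_probability_exists (fst \o cell f) mass_ge0 mass_sum1.
have errE h : err D h = mean f (mistake h).
  rewrite /err DE/= -mass_mean; apply: eq_bigr => wb _; rewrite indicE /mistake; congr (_ * _%:R).
  by congr nat_of_bool; apply/idP/idP; [rewrite inE/= => /eqP | move=> /eqP ?; rewrite inE].
have beta_le_err h : beta <= err D h.
  rewrite errE /mean ler_pdivlMl// mulrC mulr_natr -sumr_const; apply: ler_sum => w _.
  rewrite /mix /mistake/=; move: beta_itv; case: (eqVneq (h _) ord_max) => [->|_] /=.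
    by rewrite eq_sym lbl_neq_max/=; lra.
  by case: (_ == _) => /=; lra.
have lin_nonempty : [set err D f0 | f0 in @linear_classifier R d K] !=set0 by exists (err D g), g.
exists D, g; split=> //; first split=> //.
- move=> A j mA.
  have -> : marginalX D = D' :> (set point -> \bar R).
    by apply/funext => B; rewrite /marginalX /pushforward DE D'E.
  have mH : measurable_fun setT (fun v => H (g v) j).
    apply: (measurableT_comp (f := fun i : 'I_K.+1 => H i j)) => //.
    exact: measurable_linear_classifier.
  rewrite DE (intD'E A _ mA mH) (mass_mean f (\1_(A `*` [set j]))); congr EFin.
  under eq_bigr do rewrite -mulrA.
  rewrite (mass_mean f (fun z => \1_A z.1 * H (g z.1) j)) !meanE; congr (_ * _); apply: eq_bigr => x _.
  have ind v k : \1_(A `*` [set j]) (v, k) = \1_A v * (k == j)%:R :> R.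
    rewrite !indicE -natrM mulnb; congr (_%:R); congr nat_of_bool.
    apply/idP/andP; rewrite !inE/=; first by move=> [? ->].
    by move=> [? /eqP ->].
  rewrite /mix /=; under eq_bigr do rewrite !ind.
  under [RHS]eq_bigr do rewrite gE.
  have [->|jm] := eqVneq j ord_max.
    apply: eq_bigr => y _; rewrite (negbTE (lbl_neq_max y)) /H /star_noise !mxE eqxx.
    by rewrite mulr0n mulr1n; set u := \1_A _; ring.
  case hc: (central s L (level Q (hsum f x))).
    apply: eq_bigr => y _; rewrite /H /star_noise !mxE (negbTE jm) (negbTE (lbl_neq_max y)).
    by rewrite mulr0n; set u := \1_A _; ring.
  have [y0 ->] : exists y0, j = lbl y0.
    have jK : (j < K)%N by move: jm (ltn_ord j); rewrite -val_eqE /= ltnS leq_eqVlt => /negbTE->.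
    by exists (Ordinal jK); apply: val_inj.
  (* Off the centre the lead does not depend on y: only y0 contributes on the left, while all K
     labels contribute (1 - beta) / K each on the right. *)
  rewrite /lead hc !addn0; set u := \1_A _.
  rewrite (bigD1 y0)//= big1 => [|y yy0]; last first.
    by rewrite -val_eqE /= val_eqE (negbTE yy0) !mulr0 addr0.
  under [RHS]eq_bigr do rewrite /=.
  rewrite sumr_const card_ord -[RHS]mulr_natr eqxx /H /star_noise !mxE.
  rewrite (negbTE (lbl_neq_max y0)) eqxx mulr0n mulr1n; field.
  by rewrite pnatr_eq0 -lt0n.
- move=> q; rewrite unlock -mass_mean intDE//; congr EFin.
  by apply: eq_bigr => wb _; rewrite indicT mulr1.
- by apply: lb_le_inf => // _ [h _ <-].
- apply: (@le_trans _ _ (err D g)).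
    by apply: ge_inf; [exists beta => _ [h _ <-] | exists g].
  rewrite errE meanE ler_pdivrMl//.
  have -> : #|Omega|%:R * (beta + noncentral_rate f) =
     \sum_(x : cube) \sum_(y < K) (beta + (~~ central s L (level Q (hsum f x)))%:R).
    rewrite /noncentral_rate card_prod card_ord natrM.
    rewrite [RHS](eq_bigr (fun x => K%:R * (beta + (~~ central s L (level Q (hsum f x)))%:R))); last first.
      by move=> x _; rewrite sumr_const card_ord [RHS]mulr_natl.
    rewrite -mulr_sumr big_split/= sumr_const -[beta *+ _]mulr_natl; field.
    by rewrite pnatr_eq0 -lt0n; apply/card_gt0P; exists [ffun=> ord0].
  apply: ler_sum => x _; apply: ler_sum => y _; rewrite /mix /mistake /= gE.
  case: ifP => _ /=; first by rewrite eqxx (negbTE (lbl_neq_max y)) /=; lra.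
  by rewrite eqxx [ord_max == _]eq_sym (negbTE (lbl_neq_max y)) /=; move: beta_itv; lra.
Qed.
End HiddenInstance.

(** * Fooling a statistical query algorithm *)

Section SQHardness.
Variables (R : realType) (K s Q' L d : nat) (beta : R).
Let Q := Q'.+1.
Let coord : finType := ('I_s * bool * bool)%type.
Let cube : finType := {ffun coord -> 'I_Q}.
Let J : finType := option (option coord).
Let Z : finType := ('I_L.*2.+1 * 'I_K)%type.
Let Omega : finType := (cube * 'I_K)%type.
Let point := d.-tuple R.
Let H := star_noise K beta.
Implicit Types (f : {ffun 'I_s -> bool}) (x : cube) (w : Omega)
  (phi : point * 'I_K.+1 -> R).

Hypothesis K_gt0 : (0 < K)%N.
Hypothesis KQ : (K <= Q)%N.
Hypothesis sQ : (s <= Q)%N.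
Hypothesis L_gt0 : (0 < L)%N.
Hypothesis Ls : (L <= s)%N.
Hypothesis fits : (#|{: {ffun Z * bool -> J}}| <= d)%N.
Hypothesis beta_itv : 0 <= beta <= 1 / 2.

Let mixf phi w (a : 'I_(Q + K)) : R := mix beta phi (example R K L d w.1 a) w.2.

Let lead_lt f w : (lead s L w.2 Q (hsum f w.1) < Q + K)%N.
Proof.
rewrite /lead; have := @gap_lt Q (hsum f w.1) isT; have := ltn_ord w.2.
by case: ifP; lia.
Qed.

Let G f w : 'I_(Q + K) := Ordinal (lead_lt f w).

(* The expectation of phi when the lead coordinate is uniform on {0..Q-1}. *)
Definition null_mean phi : R := #|Omega|%:R^-1 *
  \sum_w Q%:R^-1 * \sum_(a < Q + K | (a < Q)%N) mixf phi w a.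

Let mean_f phi f := @mean R K s Q' L d beta f phi.

Let Omega_gt0 : (0 < #|Omega|)%N.
Proof.
rewrite card_prod card_ord muln_gt0 K_gt0 andbT.
by apply/card_gt0P; exists [ffun=> ord0].
Qed.

Let advantageE phi f :
  advantage Q G (mixf phi) f = mean_f phi f - null_mean phi.
Proof. by rewrite /advantage /mean_f /mean /null_mean sumrB mulrBr. Qed.

Let mixf_le1 phi w a : (forall z, `|phi z| <= 1) -> `|mixf phi w a| <= 1.
Proof.
move=> phi1; rewrite /mixf /mix.
apply: le_trans (ler_normD _ _) _; rewrite !normrM.
have := phi1 (example R K L d w.1 a, lbl w.2); have := phi1 (example R K L d w.1 a, ord_max).
set u := `|phi _|; set v := `|phi _|.
have [b0 b1] : 0 <= beta /\ beta <= 1 / 2 by apply/andP.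
rewrite !ger0_norm //; last lra.
have u0 : 0 <= u by exact: normr_ge0.
have v0 : 0 <= v by exact: normr_ge0.
by nra.
Qed.

Let collide f g : f != g ->
  (Q ^ 2 * \sum_w (G f w == G g w) <= #|Omega| * (Q + L.*2.+1 * K))%N.
Proof.
move=> fg; rewrite -(pair_bigA _ (fun x y => nat_of_bool (G f (x, y) == G g (x, y))))/=.
rewrite exchange_big/= big_distrr/=.
apply: (@leq_trans (\sum_(y < K) #|cube| * (Q + L.*2.+1 * K))); last first.
  by rewrite sum_nat_const card_prod card_ord mulnA [(_ * #|cube|)%N]mulnC.
apply: leq_sum => y _; apply: (leq_trans (card_lead_collide Q' Ls y fg)).
by rewrite leq_mul2l leq_add2l leq_mul2l ltnW ?ltn_ord ?orbT.
Qed.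

Let overflow f : (Q * \sum_w (Q <= G f w) <= #|Omega| * K)%N.
Proof.
rewrite -(pair_bigA _ (fun x y => nat_of_bool (Q <= G f (x, y))%N))/=.
rewrite exchange_big/= big_distrr/=.
apply: (@leq_trans (\sum_(y < K) #|cube| * K)); last first.
  by rewrite sum_nat_const card_prod card_ord mulnA [(_ * #|cube|)%N]mulnC.
apply: leq_sum => y _; apply: (leq_trans (card_lead_overflow Q' L f y (leq_trans L_gt0 Ls))).
by rewrite leq_mul2l ltnW ?ltn_ord ?orbT.
Qed.

Variable N : R.
Hypothesis N_gt0 : 0 < N.
Hypothesis NQ : 4 * ((2 * L + 3) * K)%:R * N ^+ 2 <= Q%:R.

Let card_advantage phi (F : {set {ffun 'I_s -> bool}}) : (forall z, `|phi z| <= 1) ->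
  (forall f, f \in F -> N^-1 <= mean_f phi f - null_mean phi) ->
  #|F|%:R <= 4 * Q%:R * N ^+ 2.
Proof.
move=> phi1 hF.
have tau_ge0 : 0 <= N^-1 by rewrite invr_ge0 ltW.
have adv f : f \in F -> N^-1 <= advantage Q G (mixf phi) f by rewrite advantageE; exact: hF.
have ht := @card_advantage_sqr R _ _ (Q + K) Q _ _ G (mixf phi) F isT (leq_addr _ _) Omega_gt0
  (fun w a => mixf_le1 w a phi1) collide overflow N^-1 tau_ge0 adv.
set t : R := #|F|%:R in ht *.
have t0 : 0 <= t by exact: ler0n.
have Q0 : (0 : R) < Q%:R by rewrite ltr0n.
have NQ' := NQ; set E : R := ((2 * L + 3) * K)%:R in NQ'.
have E0 : 0 <= E by exact: ler0n.
have eE : (L.*2.+1 * K + 2 * K)%:R = E by rewrite /E -mulnDl -mul2n addSnnS.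
rewrite eE in ht.
(* By [NQ] the correlation term is at most half of the left side and can be absorbed, which leaves a
   bound linear in t. *)
have h1 : (t * N^-1) ^+ 2 <= 2 * Q%:R * t + t ^+ 2 / (2 * N ^+ 2).
  apply: (le_trans ht); apply: (@le_trans _ _ (2 * Q%:R * (t + t ^+ 2 * E / Q%:R ^+ 2))).
    apply: ler_wpM2r; first by rewrite addr_ge0// divr_ge0 ?mulr_ge0 ?sqr_ge0.
    have KQR : (K%:R : R) <= Q%:R by rewrite ler_nat.
    by rewrite [(Q + K)%:R]natrD; lra.
  rewrite mulrDr lerD2l ler_pdivlMr; last by rewrite mulr_gt0 ?exprn_gt0.
  have -> : 2 * Q%:R * (t ^+ 2 * E / Q%:R ^+ 2) * (2 * N ^+ 2) = t ^+ 2 * (4 * E * N ^+ 2) / Q%:R.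
    by field; rewrite gt_eqF.
  by rewrite ler_pdivrMr// ler_wpM2l ?sqr_ge0.
have h2 : t * t <= t * (4 * Q%:R * N ^+ 2).
  have N2 : 0 < N ^+ 2 by rewrite exprn_gt0.
  have : (t * N^-1) ^+ 2 = 2 * (t ^+ 2 / (2 * N ^+ 2)) by field; rewrite gt_eqF.
  move: h1 => /[swap] -> h1.
  have : t ^+ 2 / (2 * N ^+ 2) <= 2 * Q%:R * t by lra.
  by rewrite ler_pdivrMr ?mulr_gt0//; lra.
have [t_eq0|t_neq0] := eqVneq t 0; first by rewrite t_eq0 mulr_ge0 ?sqr_ge0// mulr_ge0 ?ler0n.
by move: h2; rewrite ler_pM2l// lt_neqAle eq_sym t_neq0.
Qed.

Let bad phi := [set f | N^-1 <= `|mean_f phi f - null_mean phi|]%SET.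

Let mixN phi v y : mix beta (\- phi) v y = - mix (d := d) (K := K) beta phi v y.
Proof. by rewrite /mix /= !mulrN opprD. Qed.

Let advantageN phi f :
  mean_f (\- phi) f - null_mean (\- phi) = - (mean_f phi f - null_mean phi).
Proof.
rewrite opprB addrC; congr (_ + _).
  rewrite /null_mean -mulrN -sumrN; congr (_ * _); apply: eq_bigr => w _.
  rewrite -mulrN -sumrN; congr (_ * _); apply: eq_bigr => a _.
  by rewrite /mixf mixN opprK.
by rewrite /mean_f /mean -mulrN -sumrN; congr (_ * _); apply: eq_bigr => w _; exact: mixN.
Qed.

(** A negative deviation of phi is a positive one of its opposite, hence twice the one-sided
    bound. *)
Let card_bad phi : (forall z, `|phi z| <= 1) -> #|bad phi|%:R <= 8 * Q%:R * N ^+ 2.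
Proof.
move=> phi1.
pose above psi := [set f | N^-1 <= mean_f psi f - null_mean psi]%SET.
have le_above psi : (forall z, `|psi z| <= 1) -> #|above psi|%:R <= 4 * Q%:R * N ^+ 2.
  by move=> psi1; apply: (card_advantage psi1) => f; rewrite inE.
have /subset_leq_card : bad phi \subset (above phi :|: above (\- phi))%SET.
  by apply/fintype.subsetP => f; rewrite !inE advantageN ler_normr.
move=> /leq_trans/(_ (leq_card_setU _ _)); rewrite -(ler_nat R) natrD => h.
apply: (le_trans h); have := le_above phi phi1.
have : #|above (\- phi)|%:R <= 4 * Q%:R * N ^+ 2.
  by apply: le_above => z; rewrite normrN.
lra.
Qed.

(** Union bound: n bad sets cannot cover all 2^s secrets. *)
Let good_f_exists (n : nat) (phi_ : nat -> point * 'I_K.+1 -> R) :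
  (forall k z, `|phi_ k z| <= 1) -> n%:R * (8 * Q%:R * N ^+ 2) < 2 ^+ s ->
  exists f, forall k, (k < n)%N -> `|mean_f (phi_ k) f - null_mean (phi_ k)| < N^-1.
Proof.
move=> phi1 hn; apply: contrapT => /forallNP no.
have : (2 ^ s <= \sum_(k < n) #|bad (phi_ k)|)%N.
  rewrite -[s in (2 ^ s)%N]card_ord -card_bool -card_ffun -cardsT.
  apply: (@leq_trans #|\bigcup_(k < n) bad (phi_ k)|%SET).
    apply: subset_leq_card; apply/fintype.subsetP => f _.
    have /existsNP[k /not_implyP[kn /negP hk]] := no f.
    by apply/bigcupP; exists (Ordinal kn) => //; rewrite inE leNgt.
  elim/big_ind2: _ => [|a b c e ha hc|k _]; first by rewrite cards0.
    by apply: (leq_trans (leq_card_setU _ _)); exact: leq_add.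
  exact: leqnn.
rewrite -(ler_nat R) natrX natr_sum => h.
have : \sum_(k < n) #|bad (phi_ k)|%:R <= \sum_(k < n) 8 * Q%:R * N ^+ 2.
  by apply: ler_sum => k _; exact: card_bad.
rewrite sumr_const card_ord -[leRHS]mulr_natl => /(le_trans h).
by rewrite leNgt hn.
Qed.

(** Under the reference distribution the example is independent of y, and a prediction agrees with
    at most one of the K ordinary labels. *)
Lemma null_mean_mistake (h : point -> 'I_K.+1) :
  (1 - beta) * (1 - K%:R^-1) <= null_mean (mistake h).
Proof.
have K0 : (0 : R) < K%:R by rewrite ltr0n.
have per_example v : (1 - beta) * (K%:R - 1) <= \sum_(y < K) mix beta (mistake h) v y.
  apply: (@le_trans _ _ (\sum_(y < K) (1 - beta) * (h v != lbl y)%:R)).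
    rewrite -mulr_sumr ler_wpM2l//; first by move: beta_itv; lra.
    have -> : K%:R - 1 = \sum_(y < K) 1 - 1 :> R by rewrite sumr_const card_ord.
    rewrite lerBlDl.
    apply: (@le_trans _ _ (\sum_(y < K) ((h v == lbl y)%:R + (h v != lbl y)%:R))).
      by apply: ler_sum => y _; case: eqP => _ /=; lra.
    rewrite big_split/= lerD2r -natr_sum -[1]/(1%:R) ler_nat.
    by apply: sum_pred_le1 => y y' /eqP -> /eqP /(congr1 val) /= e; exact: val_inj.
  apply: ler_sum => y _; rewrite /mix /mistake/= lerDl mulr_ge0 ?ler0n//.
  by move: beta_itv; lra.
rewrite /null_mean ler_pdivlMl ?ltr0n//.
rewrite -(pair_bigA _ (fun x y => Q%:R^-1 * \sum_(a < Q + K | (a < Q)%N)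
  mix beta (mistake h) (example R K L d x a) y))/=.
apply: (@le_trans _ _ (\sum_(x : cube) (1 - beta) * (K%:R - 1))).
  rewrite sumr_const -[leRHS]mulr_natl card_prod card_ord natrM.
  by rewrite le_eqVlt; apply/orP; left; apply/eqP; field; rewrite gt_eqF.
apply: ler_sum => x _; rewrite -mulr_sumr ler_pdivlMl ?ltr0n// exchange_big/=.
rewrite -(big_ord_widen (Q + K) (fun a => \sum_(y < K) mix beta (mistake h) (example R K L d x a) y)) ?leq_addr//.
apply: (@le_trans _ _ (\sum_(a < Q) (1 - beta) * (K%:R - 1))).
  by rewrite sumr_const card_ord -[leRHS]mulr_natl.
by apply: ler_sum => a _; exact: per_example.
Qed.

Lemma noncentral_rate_le f : @noncentral_rate R s Q' L f <= s%:R / (2 * L%:R ^+ 2).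
Proof.
have L0 : (0 : R) < L%:R by rewrite ltr0n.
rewrite /noncentral_rate ler_pdivrMl; last by rewrite ltr0n; apply/card_gt0P; exists [ffun=> ord0].
rewrite mulrA ler_pdivlMr; last by rewrite mulr_gt0 ?exprn_gt0.
rewrite -natr_sum -natrX -!natrM ler_nat mulnC; exact: card_noncentral.
Qed.

Variables (C theta : R) (n : nat).
Hypothesis Nn : N <= n%:R.
Hypothesis n_small : n.+1%:R * (8 * Q%:R * N ^+ 2) < 2 ^+ s.
Hypothesis theta_le : theta <= beta.
Hypothesis C_gt0 : 0 < C.
Hypothesis gap_opt :
  C * (beta + s%:R / (2 * L%:R ^+ 2)) + N^-1 <= (1 - beta) * (1 - K%:R^-1).

Let promise (D : probability (point * 'I_K.+1)%type R) := theta <= opt D.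

(** The algorithm is run with reference answers. Some secret keeps all queries, and the error of a
    possible output, within 1/N of the reference. An early output would err too much, so n queries
    are asked unless one has tolerance at most 1/N. *)
Lemma sq_hardness (A : sq_algorithm R d K) :
  sq_learns H promise (fun D => C * opt D) A ->
  requires_queries H promise A N \/ requires_tolerance H promise A N^-1.
Proof.
move=> learns.
pose run := fix run k : seq R := if k is k'.+1 then
  (if A (run k') is Ask q then rcons (run k') (null_mean (query_fun q)) else run k')
  else [::].
(* An output is tested by its mistake indicator, which ties its true error to the reference
   value. *)
pose test k : point * 'I_K.+1 -> R := match A (run k) with
  | Ask q => query_fun q | Output h => mistake h end.
have test1 k z : `|test k z| <= 1.
  rewrite /test; case: (A _) => [q|h].
    by rewrite ler_norml; exact: query_bound.
  by rewrite /mistake; case: (_ != _); rewrite ?normr1 ?normr0.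
have [f hf] := good_f_exists test1 n_small.
have [D [g [rcn_g expE errE opt_ge opt_le]]] := hidden_instance K_gt0 KQ Ls fits beta_itv f.
have promD : promise D by exact: le_trans opt_ge.
have [tol|no_tol] := pselect (requires_tolerance H promise A N^-1); first by right.
left.
have step k : (k <= n)%N -> transcript D A (run k) /\ size (run k) = k.
  elim: k => [|k IH] kn; first by split.
  have [tr sz] := IH (ltnW kn).
  have hk := hf k (leqW kn); rewrite /test in hk; move: hk => /=.
  case Ak: (A (run k)) => [q|h] hk; last first.
    exfalso; have [_ /(_ _ _ tr Ak)] := learns D g rcn_g promD.
    rewrite errE => le_opt.
    have h1 := null_mean_mistake h; have h2 := noncentral_rate_le f.
    have h3 : C * opt D <= C * (beta + s%:R / (2 * L%:R ^+ 2)).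
      by rewrite ler_pM2l//; apply: le_trans opt_le _; rewrite lerD2l.
    move: hk; rewrite ltr_norml => /andP[hk _]; move: hk gap_opt h1 h3 le_opt.
    rewrite /mean_f /H; lra.
  split; last by rewrite size_rcons sz.
  move=> i; rewrite size_rcons sz ltnS leq_eqVlt => /orP[/eqP ->|ik].
    rewrite nth_rcons sz ltnn eqxx -cats1 take_size_cat//; exists q => //.
    rewrite /valid_answer expE/= distrC.
    (* The reference answer is within 1/N of the truth, so it is valid unless the tolerance is at
       most 1/N. *)
    apply: ltW; apply: lt_trans hk _; rewrite ltNge; apply/negP => tq; apply: no_tol.
    by exists D, g, (run k), q.
  have [|q' h1 h2] := tr i; [by rewrite sz | exists q'].
    by rewrite -cats1 takel_cat// sz ltnW.
  by rewrite nth_rcons sz ik.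
have [tr sz] := step n (leqnn n).
by exists D, g, (run n); split=> //; rewrite sz.
Qed.
End SQHardness.

(** * Row sums and separation of the noise matrix *)

Section StarNoise.
Variables (R : realType) (K : nat).
Hypothesis K9 : (9 <= K)%N.
Let beta : R := 2 / K%:R.

Let K0 : (0 : R) < K%:R. Proof. by rewrite ltr0n; lia. Qed.
Let beta_bounds : 0 <= beta <= 2 / 9.
Proof.
rewrite /beta divr_ge0 ?ler0n//= ler_pdivrMr//.
have : (9 : R) <= K%:R by rewrite (ler_nat R 9 K).
lra.
Qed.

Lemma star_noise_matrix : noise_matrix (star_noise K beta).
Proof.
have [b0 b1] : 0 <= beta /\ beta <= 2 / 9 by apply/andP.
have K1 : (1 : R) <= K%:R by rewrite ler1n; lia.
split=> [i j|i].
  rewrite !mxE; case: eqP => _; first lra.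
  case: eqP => _.
    rewrite divr_ge0 ?ler_pdivrMr//=; last lra.
    by rewrite mul1r; lra.
  by case: eqP => _ /=; lra.
rewrite big_ord_recr/= mxE eqxx.
have -> : \sum_(y < K) star_noise K beta i (widen_ord (leqnSn K) y) = 1 - beta; last by rewrite subrK.
have [->|im] := eqVneq i ord_max.
  rewrite (eq_bigr (fun=> (1 - beta) / K%:R)) => [|y _]; last first.
    by rewrite mxE (negbTE (lbl_neq_max y)) eqxx.
  by rewrite sumr_const card_ord -[LHS]mulr_natr divfK ?gt_eqF.
have iK : (i < K)%N by move: im (ltn_ord i); rewrite -val_eqE /= ltnS leq_eqVlt => /negbTE->.
rewrite (bigD1 (Ordinal iK))//= big1 => [|y yi].
  rewrite mxE (negbTE (lbl_neq_max _)) (negbTE im) addr0.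
  by rewrite (_ : i == _ = true) ?mulr1//; apply/eqP/val_inj.
rewrite mxE (negbTE (lbl_neq_max _)) (negbTE im).
by rewrite -val_eqE/= eq_sym -[y == i :> nat]/(y == Ordinal iK :> nat) val_eqE (negbTE yi) mulr0.
Qed.

(** The tight row is that of [ord_max], where beta = 2/K exceeds the other entries, at most 1/K, by
    at least 1/K. *)
Lemma star_noise_separation i j : i != j ->
  K%:R^-1 <= star_noise K beta i i - star_noise K beta i j.
Proof.
move=> ij; have K9' : (9 : R) <= K%:R by rewrite (ler_nat R 9 K).
have [b0 b1] : 0 <= beta /\ beta <= 2 / 9 by apply/andP.
have bE : beta = 2 * K%:R^-1 by [].
have k0 : 0 < K%:R^-1 :> R by rewrite invr_gt0.
rewrite !mxE; have [im|im] := eqVneq i ord_max.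
  rewrite -im [j == i]eq_sym (negbTE ij) bE.
  have : (1 - 2 * K%:R^-1) / K%:R <= 1 * K%:R^-1 :> R.
    by apply: ler_wpM2r; lra.
  lra.
rewrite eqxx; have [jm|jm] := eqVneq j ord_max.
  by rewrite /= mulr1; lra.
by rewrite (negbTE ij) /=; lra.
Qed.
End StarNoise.

(** * Growth estimates for the parameters *)

(** The left side will bound Q / N^2 when L = K w and s = w^2. *)
Lemma modulus_factor_poly (K w : nat) : (K <= w -> 9 <= w ->
  4 * ((2 * (K * w) + 3) * K) + 1 + K + w ^ 2 <= 9 * w ^ 3)%N.
Proof.
move=> Kw w9; have h1 : (K * w * K <= w * w * w)%N by rewrite leq_mul ?leq_mul.
have h2 : (9 * (w * w) <= w * (w * w))%N by rewrite leq_mul2r w9 orbT.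
have h3 : (9 * w <= w * w)%N by rewrite leq_mul2r w9 orbT.
rewrite !expnS expn0; lia.
Qed.

(** The left side is the degree of the Veronese embedding for L = K w. *)
Lemma feature_degree_le (K w : nat) : (0 < K -> 0 < w ->
  2 * (2 * (K * w) + 1) * K <= 6 * K ^ 2 * w)%N.
Proof.
move=> K0 w0; have h1 : (K * 1 <= K * (K * w))%N.
  by rewrite leq_mul2l muln_gt0 K0 w0 orbT.
rewrite !expnS expn0; lia.
Qed.

(* Here z = (ln d)^(1/500) and g = z^495 = (ln d)^(99/100), so that g z^5 = ln d,
   N = d^g and w is about (ln d)^(498/500); M stands for 500. *)
Section Scales.
Variables (R : realType) (K : nat) (M g z : R).
Hypothesis K_gt0 : (0 < K)%N.
Hypothesis M1 : 1 <= M.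
Hypothesis g1 : 1 <= g.
Hypothesis z_large : 100 * (K%:R ^+ 2 * M) <= z.
Hypothesis z_exp : g * z ^+ 5 <= expR (M * z).

Let w := Num.truncn (g * z ^+ 3).
Let N : R := expR (g * (g * z ^+ 5)).
Let K1 : (1 : R) <= K%:R. Proof. by rewrite ler1n. Qed.
Let z100 : 100 <= z.
Proof.
apply: le_trans z_large; rewrite ler_peMr//.
by rewrite mulr_ege1// exprn_ege1.
Qed.
Let zK : K%:R + 1 <= z.
Proof.
have k2 : (1 : R) <= K%:R ^+ 2 by rewrite exprn_ege1.
have kk : (K%:R : R) <= K%:R ^+ 2 by rewrite expr2 ler_peMr// ler0n.
have : K%:R ^+ 2 <= K%:R ^+ 2 * M by rewrite ler_peMr//; lra.
move: z_large; lra.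
Qed.

Let w_le : w%:R <= g * z ^+ 3.
Proof. by rewrite truncn_le mulr_ge0 ?exprn_ge0//; have := g1; have := z100; lra. Qed.

Let w_gt : g * z ^+ 3 < w%:R + 1.
Proof. by rewrite natr1; exact: truncnS_gt. Qed.

Let gz3_ge : z <= g * z ^+ 3.
Proof.
have z1 : 1 <= z by have := z100; lra.
rewrite -[leLHS]mul1r ler_pM//; first lra.
by rewrite ler_eXnr.
Qed.

Lemma K_le_width : (K <= w)%N.
Proof. by rewrite -(ler_nat R); have := zK; have := w_gt; have := gz3_ge; lra. Qed.

Let w9 : 9 <= w%:R :> R.
Proof. by have := z100; have := w_gt; have := gz3_ge; lra. Qed.

Let w_le_y : w%:R <= g * z ^+ 5.
Proof.
apply: le_trans w_le _; have z1 : 1 <= z by have := z100; lra.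
by rewrite ler_wpM2l ?ler_weXn2l//; have := g1; lra.
Qed.

Let y9 : 9 <= g * z ^+ 5. Proof. exact: le_trans w9 w_le_y. Qed.

Let Mz : M <= z.
Proof.
have k2 : (1 : R) <= K%:R ^+ 2 by rewrite exprn_ege1.
have : M <= K%:R ^+ 2 * M by rewrite ler_peMl//; have := M1; lra.
by have := z_large; have := M1; lra.
Qed.

(** The left side is at most (ln d)^4 <= exp (4 M z), and 4 M z <= z^5 <= ln N. *)
Lemma modulus_factor_le : (4 * ((2 * (K * w) + 3) * K) + 1 + K + w ^ 2)%:R <= N.
Proof.
have Kw := K_le_width; have M1' := M1; have z100' := z100; have Mz' := Mz.
have w3 : (9 <= w)%N by rewrite -(ler_nat R).
have := modulus_factor_poly Kw w3; rewrite -(ler_nat R) => /le_trans; apply.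
apply: (@le_trans _ _ ((g * z ^+ 5) ^+ 4)).
  rewrite natrM natrX; move: w_le_y y9; set y := g * z ^+ 5; set v := w%:R => vy y9'.
  have v3 : v ^+ 3 <= y ^+ 3 by rewrite lerXn2r ?nnegrE//; have := w9; rewrite -/v; lra.
  rewrite [leRHS]exprS; apply: (@le_trans _ _ (9 * y ^+ 3)); first by rewrite ler_pM2l.
  rewrite ler_wpM2r ?exprn_ge0//; lra.
have y0 : 0 <= g * z ^+ 5 by have := y9; lra.
apply: (@le_trans _ _ (expR (M * z) ^+ 4)); first by rewrite lerXn2r ?nnegrE ?expR_ge0.
rewrite -expRM_natl ler_expR.
apply: (@le_trans _ _ (z ^+ 5)).
  apply: (@le_trans _ _ (z * (z * z))); first by rewrite ler_pM//; nra.
  by rewrite -expr2 -exprS ler_weXn2l//; lra.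
have z5 : 0 <= z ^+ 5 by rewrite exprn_ge0//; lra.
by rewrite mulrA ler_peMl// mulr_ege1.
Qed.

Lemma inv_tolerance_ge6 : 6 <= N.
Proof.
have w9n : (9 <= w)%N by rewrite -(ler_nat R).
apply: le_trans modulus_factor_le; rewrite (ler_nat R 6); apply: leq_trans (leq_addl _ _).
by apply: (@leq_trans (3 ^ 2)) => //; rewrite leq_sqr (leq_trans _ w9n).
Qed.

(** Since (g z^3)^2 = z ln N, the exponent w^2 is at least z ln N / 4 >= 25 ln N, while 2 >= exp
    (1/2). *)
Lemma inv_tolerance_pow8 : N ^+ 8 < 2 ^+ (w ^ 2).
Proof.
have exp_half : expR (1 / 2) <= 2 :> R.
  have := @expR_ge1Dx R (- (1 / 2)); rewrite expRN => h.
  have e0 := @expR_gt0 R (1 / 2).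
  by rewrite -[leRHS]invrK -[leLHS]invrK lef_pV2 ?posrE ?invr_gt0//; lra.
apply: (@lt_le_trans _ _ (expR (1 / 2) ^+ (w ^ 2))); last by rewrite lerXn2r ?nnegrE ?expR_ge0.
rewrite -!expRM_natl ltr_expR natrX.
have z100' := z100; have w9' := w9.
have a0 : 0 < g * z ^+ 3 by have := gz3_ge; lra.
have half : (g * z ^+ 3) / 2 <= w%:R by have := w_gt; lra.
have : ((g * z ^+ 3) / 2) ^+ 2 <= w%:R ^+ 2 by rewrite lerXn2r ?nnegrE//; lra.
have e1 : ((g * z ^+ 3) / 2) ^+ 2 = z * (g * (g * z ^+ 5)) / 4 by field.
rewrite e1; set b := g * (g * z ^+ 5).
have b0 : 0 < b by rewrite !mulr_gt0 ?exprn_gt0//; have := g1; lra.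
have : 100 * b <= z * b by rewrite ler_pM2r.
lra.
Qed.

(** This makes the embedding fit into dimension d. The base is at most exp (3 M z) and the exponent
    at most 6 K^2 g z^3, so the logarithm is at most 18 K^2 M g z^4 <= g z^5. *)
Lemma feature_count_le : ((4 * w ^ 2 + 2) ^ (2 * (2 * (K * w) + 1) * K))%:R <= expR (g * z ^+ 5).
Proof.
have w9' := w9; have Kw := K_le_width; have z100' := z100; have g1' := g1; have M1' := M1.
have wy := w_le_y; have y9' := y9; have K1' := K1.
have base : (4 * w ^ 2 + 2)%:R <= expR (3 * (M * z)).
  rewrite expRM_natl; apply: (@le_trans _ _ ((g * z ^+ 5) ^+ 3)); last first.
    by rewrite lerXn2r ?nnegrE ?expR_ge0//; lra.
  rewrite natrD natrM natrX; move: wy y9'; set y := g * z ^+ 5; set v := w%:R => vy y9'.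
  have v2 : v ^+ 2 <= y ^+ 2 by rewrite lerXn2r ?nnegrE//; lra.
  have y2 : 81 <= y ^+ 2 by rewrite expr2; nra.
  rewrite exprS; have : 9 * y ^+ 2 <= y * y ^+ 2 by rewrite ler_wpM2r ?sqr_ge0.
  lra.
rewrite natrX; apply: (@le_trans _ _ (expR (3 * (M * z)) ^+ (2 * (2 * (K * w) + 1) * K))).
  by rewrite lerXn2r ?nnegrE ?ler0n ?expR_ge0.
rewrite -expRM_natl ler_expR.
apply: (@le_trans _ _ ((6 * K%:R ^+ 2 * (g * z ^+ 3)) * (3 * (M * z)))).
  apply: ler_wpM2r; first by rewrite !mulr_ge0//; lra.
  apply: (@le_trans _ _ (6 * K%:R ^+ 2 * w%:R)); last first.
    by rewrite ler_wpM2l ?w_le// mulr_ge0// sqr_ge0.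
  by rewrite -natrX -!natrM ler_nat; apply: feature_degree_le => //; exact: leq_trans Kw.
have -> : 6 * K%:R ^+ 2 * (g * z ^+ 3) * (3 * (M * z)) = (18 * (K%:R ^+ 2 * M)) * (g * z ^+ 4) by ring.
have -> : g * z ^+ 5 = z * (g * z ^+ 4) by ring.
apply: ler_wpM2r; first by rewrite mulr_ge0 ?exprn_ge0//; lra.
have : 0 <= K%:R ^+ 2 * M by rewrite mulr_ge0 ?sqr_ge0//; lra.
have := z_large; lra.
Qed.
End Scales.

Lemma powR_invn_ge1 (R : realType) (y : R) (n : nat) : 1 <= y -> 1 <= y `^ n%:R^-1.
Proof.
move=> y1; have n0 : 0 <= n%:R^-1 :> R by rewrite invr_ge0.
by have := ler_powR y1 n0; rewrite powRr0.
Qed.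

Lemma powR_invn_exprn (R : realType) (y : R) (n k : nat) :
  (y `^ n%:R^-1) ^+ k = y `^ (k%:R / n%:R).
Proof. by rewrite -powR_mulrn ?powR_ge0// -powRrM mulrC. Qed.

Lemma exprn_le_expR (R : realType) (z : R) (n : nat) : 0 <= z -> z ^+ n <= expR (n%:R * z).
Proof.
move=> z0; rewrite expRM_natl lerXn2r ?nnegrE ?expR_ge0//.
by have := @expR_ge1Dx R z; lra.
Qed.

(** * Choice of the parameters *)

Theorem corollary6p3 (R : realType) :
  exists c1 c2 c3 c4 : R, [/\ 0 < c1, 0 < c2, 0 < c3 & 0 < c4] /\
  forall C : R, 1 < C ->
  exists (m : nat) (H : 'M[R]_m.+1),
    [/\ (1 < m.+1)%N,
        m.+1%:R <= c1 * C,
        noise_matrix H,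
        (forall i j : 'I_m.+1, i != j -> c2 / C <= H i i - H i j) &
        exists d0 : nat, forall d : nat, (0 < d)%N -> (d0 <= d)%N ->
        let N := d%:R `^ (c4 * ln d%:R `^ (99%:R / 100%:R)) in
        let promise := fun D : probability (d.-tuple R * 'I_m.+1)%type R =>
          c3 / C <= opt D in
        forall A : sq_algorithm R d m,
          sq_learns H promise (fun D => C * opt D) A ->
          requires_queries H promise A N \/
          requires_tolerance H promise A (1 / N)].
Proof.
(* With 8 C < K <= 8 C + 1 and C > 1, there are K + 1 <= 10 C labels, the separation 1/K is at least
   1/(9 C), and beta = 2/K is at least 2/(9 C). *)
exists 10, (1 / 9), (2 / 9), 1; split; first by split; lra.
move=> C C1; pose K := (Num.truncn (8 * C)).+1.
have K_gt : 8 * C < K%:R by exact: truncnS_gt.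
have K_le : K%:R <= 8 * C + 1.
  rewrite /K -natr1 lerD2r truncn_le; lra.
have K9 : (9 <= K)%N by rewrite -(ltr_nat R 8 K); lra.
clearbody K; pose beta : R := 2 / K%:R.
have K9R : (9 : R) <= K%:R by rewrite (ler_nat R 9 K).
have K0 : (0 : R) < K%:R by lra.
have KV_ge : (1 / 9) / C <= K%:R^-1.
  have -> : (1 / 9) / C = (9 * C)^-1 by field; rewrite gt_eqF//; lra.
  by rewrite lef_pV2 ?posrE//; lra.
exists K, (star_noise K beta); split.
- by rewrite ltnS (leq_trans _ K9).
- by rewrite -natr1; lra.
- exact: star_noise_matrix.
- by move=> i j ij; apply: le_trans KV_ge _; exact: star_noise_separation.
pose M : R := 500%:R; pose z0 : R := 100 * (K%:R ^+ 2 * M).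
(* This forces (ln d)^(1/500) >= z0. *)
pose d0 := (Num.truncn (expR (z0 ^+ 500))).+1.
exists d0 => d d_gt0 d0d N promise A learns.
have M1 : 1 <= M by rewrite ler1n.
have K2 : (1 : R) <= K%:R ^+ 2 by rewrite exprn_ege1//; lra.
have z0_ge1 : 1 <= z0.
  have : 1 <= K%:R ^+ 2 * M by exact: mulr_ege1.
  by rewrite /z0; lra.
have dR : 0 < d%:R :> R by rewrite ltr0n.
have ln_d : z0 ^+ 500 <= ln d%:R.
  rewrite -ler_expR lnK ?posrE//; apply: ltW; apply: lt_le_trans (truncnS_gt _) _.
  by rewrite ler_nat.
have ln1 : 1 <= ln d%:R :> R by apply: le_trans ln_d; rewrite exprn_ege1.
pose z := ln d%:R `^ (500%:R)^-1 : R.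
have z1 : 1 <= z := powR_invn_ge1 500 ln1.
have lnE : ln d%:R = z ^+ 500.
  by rewrite powR_invn_exprn divff ?pnatr_eq0// powRr1//; lra.
have powE : ln d%:R `^ (99%:R / 100%:R) = z ^+ 495.
  rewrite powR_invn_exprn; congr powR; apply/eqP.
  by rewrite eqr_div ?pnatr_eq0// -!natrM eqr_nat.
have z_large : z0 <= z.
  rewrite -(@ler_pXn2r _ 500)// ?nnegrE; [by rewrite -lnE|lra|lra].
pose g := z ^+ 495.
have gE : g * z ^+ 5 = ln d%:R by rewrite lnE -exprD.
have g1 : 1 <= g by rewrite exprn_ege1.
have z_exp : g * z ^+ 5 <= expR (M * z).
  by rewrite gE lnE; apply: exprn_le_expR; lra.
have NE : N = expR (g * (g * z ^+ 5)).
  by rewrite /N /powR gt_eqF// mul1r -/(powR _ _) powE gE.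
have Kpos : (0 < K)%N by exact: leq_trans K9.
pose w := Num.truncn (g * z ^+ 3).
have Kw : (K <= w)%N := K_le_width Kpos M1 g1 z_large.
have N_ge := modulus_factor_le Kpos M1 g1 z_large z_exp.
have N6 := inv_tolerance_ge6 Kpos M1 g1 z_large z_exp.
have N_pow := inv_tolerance_pow8 Kpos M1 g1 z_large.
have dim := feature_count_le Kpos M1 g1 z_large z_exp.
rewrite -NE in N6; rewrite -/w -NE in N_ge N_pow.
have fits : ((4 * w ^ 2 + 2) ^ (2 * (2 * (K * w) + 1) * K) <= d)%N.
  by rewrite -(ler_nat R) -[leRHS]lnK ?posrE// -gE; exact: dim.
clearbody w z M; clear dim d0d ln_d lnE powE d0.
have N0 : 0 < N by lra.
pose E : R := 4 * ((2 * (K * w) + 3) * K)%:R * N ^+ 2.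
(* The three summands secure the correlation bound, K <= Q and s <= Q, while Q stays below N^3. *)
pose Q' := (Num.truncn E + K + w ^ 2)%N.
have E0 : 0 <= E by rewrite mulr_ge0 ?sqr_ge0// mulr_ge0 ?ler0n.
have EQ : E <= Q'.+1%:R.
  by apply: ltW; apply: lt_le_trans (truncnS_gt _) _; rewrite ler_nat ltnS /Q' -addnA leq_addr.
have QN : Q'.+1%:R <= N ^+ 3.
  have hE : (Num.truncn E)%:R <= E by rewrite truncn_le.
  apply: (@le_trans _ _ (E + (1 + K + w ^ 2)%:R * N ^+ 2)).
    have -> : Q'.+1 = (Num.truncn E + (1 + K + w ^ 2))%N by rewrite /Q' -addnA -addnS.
    rewrite natrD lerD// ler_peMr ?ler0n// exprn_ege1//; lra.
  have -> : E + (1 + K + w ^ 2)%:R * N ^+ 2 =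
      (4 * ((2 * (K * w) + 3) * K) + 1 + K + w ^ 2)%:R * N ^+ 2.
    by rewrite /E -(natrM _ 4) -mulrDl -natrD -!addnA.
  by rewrite [leRHS]exprS ler_wpM2r ?sqr_ge0.
pose n := (Num.truncn N).+1.
have Nn : N <= n%:R by apply: ltW; exact: truncnS_gt.
have nN : n.+1%:R <= N + 2.
  have : (Num.truncn N)%:R <= N by rewrite truncn_le ltW.
  by rewrite /n -!natr1; lra.
have w_gt0 : (0 < w)%N := leq_trans Kpos Kw.
have KQ : (K <= Q'.+1)%N by apply: leqW; rewrite /Q' -addnA addnCA leq_addr.
have sQ : (w ^ 2 <= Q'.+1)%N by apply: leqW; rewrite leq_addl.
have L_gt0 : (0 < K * w)%N by rewrite muln_gt0 Kpos.
have Ls : (K * w <= w ^ 2)%N by rewrite -mulnn leq_mul2r Kw orbT.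
have card_features : (#|{: {ffun ('I_(K * w).*2.+1 * 'I_K) * bool ->
    option (option ('I_(w ^ 2) * bool * bool))}}| <= d)%N.
  apply: leq_trans fits; rewrite card_ffun !card_option !card_prod !card_ord !card_bool.
  by rewrite eq_leq//; congr (_ ^ _)%N; clear; lia.
have beta_itv : 0 <= beta <= 1 / 2.
  by rewrite divr_ge0 ?ler0n//= ler_pdivrMr//; lra.
(* The left side is at most 2 N * 8 N^5 = 16 N^6 <= N^8, as N >= 6. *)
have n_small : n.+1%:R * (8 * Q'.+1%:R * N ^+ 2) < 2 ^+ (w ^ 2) :> R.
  apply: le_lt_trans N_pow; apply: (@le_trans _ _ ((2 * N) * (8 * N ^+ 3 * N ^+ 2))).
    have N2 : 0 <= N ^+ 2 by exact: sqr_ge0.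
    rewrite ler_pM//; [by apply: mulr_ge0 => //; apply: mulr_ge0; rewrite ler0n| lra|].
    by rewrite ler_wpM2r// ler_wpM2l.
  have -> : 2 * N * (8 * N ^+ 3 * N ^+ 2) = 16 * N ^+ 6 by ring.
  have -> : N ^+ 8 = N ^+ 2 * N ^+ 6 by ring.
  by rewrite ler_wpM2r ?exprn_ge0//; [lra|nra].
have theta_le : 2 / 9 / C <= beta.
  by have -> : 2 / 9 / C = 2 * (1 / 9 / C); [lra | rewrite /beta; lra].
have C_gt0 : 0 < C by lra.
(* Since C / K <= 1/8, the left side is at most 1/4 + 1/144 + 1/6, and K >= 9 makes the right side
   at least 56/81. *)
have gap_opt : C * (beta + (w ^ 2)%:R / (2 * (K * w)%:R ^+ 2)) + N^-1 <=
    (1 - beta) * (1 - K%:R^-1).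
  have -> : (w ^ 2)%:R / (2 * (K * w)%:R ^+ 2) = K%:R^-1 ^+ 2 / 2 :> R.
    by rewrite natrX natrM; field; rewrite !pnatr_eq0 -!lt0n w_gt0 Kpos.
  have N6' : N^-1 <= 6^-1 by rewrite lef_pV2 ?posrE//; lra.
  have CK : C * K%:R^-1 <= 8^-1 by rewrite ler_pdivrMr//; lra.
  have r0 : 0 < K%:R^-1 :> R by rewrite invr_gt0.
  have r9 : K%:R^-1 <= 9^-1 :> R by rewrite lef_pV2 ?posrE//; lra.
  have -> : beta = 2 * K%:R^-1 by [].
  move: CK r0 r9 N6'; set r := K%:R^-1; set u := N^-1 => CK r0 r9 u6.
  have : C * r * r <= 8^-1 * 9^-1 by rewrite ler_pM// ltW// mulr_gt0.
  nra.
by rewrite div1r; exact: (sq_hardness Kpos KQ sQ L_gt0 Ls card_features beta_itv N0 EQ Nn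
  n_small theta_le C_gt0 gap_opt learns).
Qed.
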